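(* Let $M$ be a contact $CR$-submanifold of a Sasakian statistical manifold $(\bar M,\bar\nabla,\bar g,\phi,\xi)$, with distributions $D$ and $D^\perp$. Then $M$ is mixed totally geodesic with respect to $\bar\nabla$ (respectively $\bar\nabla^*$) if and only if for every normal vector field $V$ both of the following hold: (i) $A_VX\in\Gamma(D)$ (respectively $A^*_VX\in\Gamma(D)$) for all $X\in\Gamma(D)$; (ii) $A_VX\in\Gamma(D^\perp)$ (respectively $A^*_VX\in\Gamma(D^\perp)$) for all $X\in\Gamma(D^\perp)$.
   Context: A statistical manifold $(\bar M,\bar\nabla,\bar g)$ is a smooth Riemannian manifold $(\bar M,\bar g)$ with a torsion-free affine connection $\bar\nabla$ such that $(\bar\nabla_X\bar g)(Y,Z)=(\bar\nabla_Y\bar g)(X,Z)$. The dual connection $\bar\nabla^*$ is defined by $X\bar g(Y,Z)=\bar g(\bar\nabla_XY,Z)+\bar g(Y,\bar\nabla^*_XZ)$. Let $\hat{\bar\nabla}$ be the Levi-Civita connection of $\bar g$ and $K(X,Y)=\bar\nabla_XY-\hat{\bar\nabla}_XY$. An almost contact metric structure on an odd-dimensional $(\bar M,\bar g)$ consists of a $(1,1)$-tensor $\phi$, a unit vector field $\xi$ and a 1-form $\eta$ with $\phi^2X=-X+\eta(X)\xi$, $\bar g(X,\xi)=\eta(X)$, $\bar g(\phi X,\phi Y)=\bar g(X,Y)-\eta(X)\eta(Y)$ (so $\phi\xi=0$, $\eta\circ\phi=0$, $\bar g(\phi X,Y)=-\bar g(X,\phi Y)$). A Sasakian statistical manifold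 $(\bar M,\bar\nabla,\bar g,\phi,\xi)$ is a statistical manifold with an almost contact metric structure such that $\hat{\bar\nabla}_X\xi=\phi X$, $(\hat{\bar\nabla}_X\phi)Y=\bar g(Y,\xi)X-\bar g(Y,X)\xi$ and $K(X,\phi Y)+\phi K(X,Y)=0$. Consequently $\bar\nabla_X\phi Y-\phi\bar\nabla^*_XY=\bar g(Y,\xi)X-\bar g(Y,X)\xi$ and $\bar\nabla_X\xi=\phi X+\bar g(\bar\nabla_X\xi,\xi)\xi$, and the same identities hold with $\bar\nabla$ and $\bar\nabla^*$ interchanged. For a submanifold $M$ with induced metric $g$ ($g$ also denotes $\bar g$ on normal vectors), $X,Y\in\Gamma(TM)$ and $V\in\Gamma(T^\perp M)$, split into tangential and normal parts: $\bar\nabla_XY=\nabla_XY+h(X,Y)$, $\bar\nabla^*_XY=\nabla^*_XY+h^*(X,Y)$, $\bar\nabla_XV=-A_VX+\nabla^\perp_XV$, $\bar\nabla^*_XV=-A^*_VX+\nabla^{*\perp}_XV$. One has $g(A_VX,Y)=g(h^*(X,Y),V)$ and $g(A^*_VX,Y)=g(h(X,Y),V)$. $M$ is a contact $CR$-submanifold if $TM=D\oplus D^\perp$ for a differentiable distribution $D$ with $\xi\in\Gamma(D)$, $\phi(D_x)\subseteq D_x$, and with orthogonal complement $D^\perp$ satisfying $\phi(D^\perp_x)\subseteq T^\perp_xM$ for all $x\in M$. It is mixed totally geodesic with respect to $\bar\nabla$ (respectively $\bar\nabla^*$) if $h(X,Y)=0$ (respectively $h^*(X,Y)=0$) for all $X\in\Gamma(D)$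 and $Y\in\Gamma(D^\perp)$. *)

(* Defs.v *)
From HB Require Import structures.
From mathcomp Require Import all_boot all_order all_algebra.
From mathcomp Require Import all_classical all_reals all_analysis.

Set Implicit Arguments.
Unset Strict Implicit.
Unset Printing Implicit Defensive.

Import Order.TTheory GRing.Theory Num.Theory numFieldNormedType.Exports.
Local Open Scope classical_set_scope.
Local Open Scope ring_scope.

(** * Smooth functions on open subsets of R^n *)

Fixpoint Ck (R : realType) (n k : nat) (O : set 'rV[R]_n) (f : 'rV[R]_n -> R)
    : Prop :=
  match k with
  | 0 => forall x, O x -> {for x, continuous f}
  | k'.+1 => (forall x, O x -> differentiable f x) /\
             (forall i : 'I_n, Ck k' O (fun x => 'D_(delta_mx 0 i) f x))
  end.

Definition smooth_on (R : realType) (n : nat) (O : set 'rV[R]_n)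
  (f : 'rV[R]_n -> R) : Prop := forall k, Ck k O f.

(* [f] is C^oo on some neighbourhood of [x]; elsewhere it is arbitrary. *)
Definition smooth_near (R : realType) (n : nat) (x : 'rV[R]_n)
    (f : 'rV[R]_n -> R) : Prop :=
  exists O : set 'rV[R]_n, [/\ open O, O x & smooth_on O f].

(** * Manifolds *)

Record chart (R : realType) (T : topologicalType) (n : nat) := Chart {
  chart_dom : set T;
  chart_cod : set 'rV[R]_n;
  chart_coord : T -> 'rV[R]_n;
  chart_param : 'rV[R]_n -> T;
  chart_dom_open : open chart_dom;
  chart_cod_open : open chart_cod;
  chart_coord_cod : forall p, chart_dom p -> chart_cod (chart_coord p);
  chart_param_dom : forall x, chart_cod x -> chart_dom (chart_param x);
  chart_coordK : forall p, chart_dom p -> chart_param (chart_coord p) = p;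
  chart_paramK : forall x, chart_cod x -> chart_coord (chart_param x) = x;
  chart_coord_cts : forall p, chart_dom p -> {for p, continuous chart_coord};
  chart_param_cts : forall x, chart_cod x -> {for x, continuous chart_param}
}.

(* The atlas is indexed by the points of the manifold: [chart_at p] is a chart
   around [p]. Every atlas contains such a subfamily, and it generates the same
   smooth structure. *)
Record manifold (R : realType) (n : nat) := Manifold {
  pt :> topologicalType;
  chart_at : pt -> chart R pt n;
  manifold_hausdorff : hausdorff_space pt;
  manifold_second_countable : @second_countable pt;
  chart_at_dom : forall p, chart_dom (chart_at p) p;
  chart_at_compat : forall (p q : pt) (i : 'I_n),
    smooth_on
      (chart_cod (chart_at p) `&`
       [set x | chart_dom (chart_at q) (chart_param (chart_at p) x)])
      (fun x => chart_coord (chart_at q) (chart_param (chart_at p) x) 0 i)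
}.

(* The tangent space T_pM is R^n, through the coordinates of [chart_at p]: the
   row vector [v] stands for sum_i (v 0 i) d/dx^i, x^i being the coordinates
   of [chart_at p].  [der f p v] is the derivative of the (scalar or
   vector-valued) function [f] at [p] along the tangent vector [v]. *)
Definition der (R : realType) (n : nat) (M : manifold R n)
    (W : normedModType R) (f : M -> W) (p : M) (v : 'rV[R]_n) : W :=
  'D_v (fun x => f (chart_param (chart_at p) x)) (chart_coord (chart_at p) p).

Definition smooth_fun_at (R : realType) (n : nat) (M : manifold R n)
    (f : M -> R) (p : M) : Prop :=
  smooth_near (chart_coord (chart_at p) p)
    (fun x => f (chart_param (chart_at p) x)).

Definition smooth_map (R : realType) (m n : nat) (M : manifold R m)
    (N : manifold R n) (F : M -> N) : Prop :=
  continuous F /\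
  forall p i, smooth_fun_at (fun q => chart_coord (chart_at (F p)) (F q) 0 i) p.

(* The differential T_pM -> T_(F p)N. *)
Definition dmap (R : realType) (m n : nat) (M : manifold R m)
    (N : manifold R n) (F : M -> N) (p : M) (v : 'rV[R]_m) : 'rV[R]_n :=
  der (fun q => chart_coord (chart_at (F p)) (F q)) p v.

(** * Vector fields and tensors *)

(* A section of the pullback bundle F^*TN is a function [W] with
   [W q] in T_(F q)N.  [comp_along F W p q] is the component vector of [W q]
   in the single chart [chart_at (F p)]; it is meaningful for [q] near [p]. *)
Definition comp_along (R : realType) (m n : nat) (M : manifold R m)
    (N : manifold R n) (F : M -> N) (W : M -> 'rV[R]_n) (p q : M)
    : 'rV[R]_n :=
  der (chart_coord (chart_at (F p))) (F q) (W q).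

Definition smooth_along_at (R : realType) (m n : nat) (M : manifold R m)
    (N : manifold R n) (F : M -> N) (W : M -> 'rV[R]_n) (p : M) : Prop :=
  forall i, smooth_fun_at (fun q => comp_along F W p q 0 i) p.

Definition smooth_along (R : realType) (m n : nat) (M : manifold R m)
    (N : manifold R n) (F : M -> N) (W : M -> 'rV[R]_n) : Prop :=
  forall p, smooth_along_at F W p.

Definition smooth_vf_at (R : realType) (n : nat) (M : manifold R n)
    (X : M -> 'rV[R]_n) (p : M) : Prop := smooth_along_at id X p.

Definition smooth_vf (R : realType) (n : nat) (M : manifold R n)
    (X : M -> 'rV[R]_n) : Prop := forall p, smooth_vf_at X p.

(* The coordinate field d/dx^k of the chart [chart_at p]. *)
Definition coord_vf (R : realType) (n : nat) (M : manifold R n) (p : M)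
    (k : 'I_n) (q : M) : 'rV[R]_n :=
  'D_(delta_mx 0 k)
    (fun x => chart_coord (chart_at q) (chart_param (chart_at p) x))
    (chart_coord (chart_at p) q).

Definition lie_bracket (R : realType) (n : nat) (M : manifold R n)
    (X Y : M -> 'rV[R]_n) (p : M) : 'rV[R]_n :=
  der (comp_along id Y p) p (X p) - der (comp_along id X p) p (Y p).

Record riem_metric (R : realType) (n : nat) (M : manifold R n) := RiemMetric {
  ip :> M -> 'rV[R]_n -> 'rV[R]_n -> R;
  ip_lin : forall p w, scalar (fun v => ip p v w);
  ip_sym : forall p v w, ip p v w = ip p w v;
  ip_pos : forall p v, v != 0 -> 0 < ip p v v;
  ip_smooth : forall p (X Y : M -> 'rV[R]_n),
    smooth_vf_at X p -> smooth_vf_at Y p ->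
    smooth_fun_at (fun q => ip q (X q) (Y q)) p
}.

Record tensor11 (R : realType) (n : nat) (M : manifold R n) := Tensor11 {
  t11 :> M -> 'rV[R]_n -> 'rV[R]_n;
  t11_lin : forall p, linear (t11 p);
  t11_smooth : forall p (X : M -> 'rV[R]_n),
    smooth_vf_at X p -> smooth_vf_at (fun q => t11 q (X q)) p
}.

Record one_form (R : realType) (n : nat) (M : manifold R n) := OneForm {
  form1 :> M -> 'rV[R]_n -> R;
  form1_lin : forall p, scalar (form1 p);
  form1_smooth : forall p (X : M -> 'rV[R]_n),
    smooth_vf_at X p -> smooth_fun_at (fun q => form1 q (X q)) p
}.

(** * Affine connections *)

(* [nabla p v Y] is the covariant derivative at [p] of [Y] along [v] in T_pM,
   for [Y] smooth near [p]; no condition is put on other [Y].  As [f] and [Y]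
   are only required to be smooth near [p], the Leibniz rule makes
   [nabla p v Y] depend on the germ of [Y] at [p] only, so this is the usual
   notion of a connection acting on local vector fields. *)
Record connection (R : realType) (n : nat) (M : manifold R n) := Connection {
  nabla :> M -> 'rV[R]_n -> (M -> 'rV[R]_n) -> 'rV[R]_n;
  nabla_lin : forall p (Y : M -> 'rV[R]_n),
    smooth_vf_at Y p -> linear (fun v => nabla p v Y);
  nablaD : forall p v (Y Z : M -> 'rV[R]_n),
    smooth_vf_at Y p -> smooth_vf_at Z p ->
    nabla p v (fun q => Y q + Z q) = nabla p v Y + nabla p v Z;
  nabla_leibniz : forall p v (f : M -> R) (Y : M -> 'rV[R]_n),
    smooth_fun_at f p -> smooth_vf_at Y p ->
    nabla p v (fun q => f q *: Y q) = der f p v *: Y p + f p *: nabla p v Y;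
  nabla_smooth : forall p (X Y : M -> 'rV[R]_n),
    smooth_vf_at X p -> smooth_vf_at Y p ->
    smooth_vf_at (fun q => nabla q (X q) Y) p
}.

Definition cov (R : realType) (n : nat) (M : manifold R n) (C : connection M)
    (X Y : M -> 'rV[R]_n) : M -> 'rV[R]_n := fun p => C p (X p) Y.

Definition torsion_free (R : realType) (n : nat) (M : manifold R n)
    (C : connection M) : Prop :=
  forall p (X Y : M -> 'rV[R]_n), smooth_vf_at X p -> smooth_vf_at Y p ->
    cov C X Y p - cov C Y X p = lie_bracket X Y p.

(* (nabla_X g)(Y, Z) *)
Definition cov_metric (R : realType) (n : nat) (M : manifold R n)
    (C : connection M) (g : riem_metric M) (X Y Z : M -> 'rV[R]_n) (p : M)
    : R :=
  der (fun q => g q (Y q) (Z q)) p (X p)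
  - g p (cov C X Y p) (Z p) - g p (Y p) (cov C X Z p).

Definition levi_civita (R : realType) (n : nat) (M : manifold R n)
    (g : riem_metric M) (C : connection M) : Prop :=
  torsion_free C /\
  forall p (X Y Z : M -> 'rV[R]_n),
    smooth_vf_at X p -> smooth_vf_at Y p -> smooth_vf_at Z p ->
    cov_metric C g X Y Z p = 0.

Definition statistical (R : realType) (n : nat) (M : manifold R n)
    (g : riem_metric M) (C : connection M) : Prop :=
  torsion_free C /\
  forall p (X Y Z : M -> 'rV[R]_n),
    smooth_vf_at X p -> smooth_vf_at Y p -> smooth_vf_at Z p ->
    cov_metric C g X Y Z p = cov_metric C g Y X Z p.

Definition dual_connection (R : realType) (n : nat) (M : manifold R n)
    (g : riem_metric M) (C Cs : connection M) : Prop :=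
  forall p (X Y Z : M -> 'rV[R]_n),
    smooth_vf_at X p -> smooth_vf_at Y p -> smooth_vf_at Z p ->
    der (fun q => g q (Y q) (Z q)) p (X p) =
    g p (cov C X Y p) (Z p) + g p (Y p) (cov Cs X Z p).

(** * Sasakian statistical manifolds *)

Record almost_contact_metric (R : realType) (n : nat) (M : manifold R n)
    (g : riem_metric M) (phi : tensor11 M) (xi : M -> 'rV[R]_n)
    (eta : one_form M) : Prop := AlmostContactMetric {
  acm_odd : odd n;
  acm_xi_smooth : smooth_vf xi;
  acm_xi_unit : forall p, g p (xi p) (xi p) = 1;
  acm_phi2 : forall p v, phi p (phi p v) = - v + eta p v *: xi p;
  acm_eta : forall p v, g p v (xi p) = eta p v;
  acm_phi_ip : forall p v w,
    g p (phi p v) (phi p w) = g p v w - eta p v * eta p w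
}.

(* K(X, Y), for the statistical connection [C] and the Levi-Civita connection
   [L]. *)
Definition diff_tensor (R : realType) (n : nat) (M : manifold R n)
    (C L : connection M) (X Y : M -> 'rV[R]_n) (p : M) : 'rV[R]_n :=
  cov C X Y p - cov L X Y p.

Record sasakian_statistical (R : realType) (n : nat) (M : manifold R n)
    (g : riem_metric M) (C L : connection M) (phi : tensor11 M)
    (xi : M -> 'rV[R]_n) (eta : one_form M) : Prop := SasakianStatistical {
  sas_statistical : statistical g C;
  sas_levi_civita : levi_civita g L;
  sas_acm : almost_contact_metric g phi xi eta;
  sas_xi : forall p (X : M -> 'rV[R]_n), smooth_vf_at X p ->
    cov L X xi p = phi p (X p);
  sas_phi : forall p (X Y : M -> 'rV[R]_n),
    smooth_vf_at X p -> smooth_vf_at Y p ->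
    cov L X (fun q => phi q (Y q)) p - phi p (cov L X Y p) =
    g p (Y p) (xi p) *: X p - g p (Y p) (X p) *: xi p;
  sas_K : forall p (X Y : M -> 'rV[R]_n),
    smooth_vf_at X p -> smooth_vf_at Y p ->
    diff_tensor C L X (fun q => phi q (Y q)) p
    + phi p (diff_tensor C L X Y p) = 0
}.

(** * Submanifolds *)

Record submanifold (R : realType) (m n : nat) (M : manifold R m)
    (N : manifold R n) (iota : M -> N) : Prop := Submanifold {
  sub_smooth : smooth_map iota;
  sub_inj : injective iota;
  sub_immersion : forall p, injective (dmap iota p)
}.

Definition induced (R : realType) (m n : nat) (M : manifold R m)
    (N : manifold R n) (iota : M -> N) (g : riem_metric N) (p : M)
    (u v : 'rV[R]_m) : R :=
  g (iota p) (dmap iota p u) (dmap iota p v).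

(* The field X tangent to M, seen as a section of iota^*TN. *)
Definition push (R : realType) (m n : nat) (M : manifold R m)
    (N : manifold R n) (iota : M -> N) (X : M -> 'rV[R]_m) (p : M)
    : 'rV[R]_n := dmap iota p (X p).

(* The covariant derivative, along X tangent to M, of a section W of
   iota^*TN: writing W = sum_k W^k (e_k o iota) near p, with e_k the
   coordinate fields of [chart_at (iota p)], it is
   sum_k X(W^k) e_k + W^k (nabla_(d iota X) e_k).
   At iota p itself e_k is the k-th basis vector, and W^k(p) = W p 0 k.  When W
   is the restriction of a vector field Z on N, it is nabla_(d iota X) Z. *)
Definition cov_along (R : realType) (m n : nat) (M : manifold R m)
    (N : manifold R n) (iota : M -> N) (C : connection N)
    (X : M -> 'rV[R]_m) (W : M -> 'rV[R]_n) (p : M) : 'rV[R]_n :=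
  der (comp_along iota W p) p (X p)
  + \sum_(k < n) W p 0 k *: C (iota p) (push iota X p) (coord_vf (iota p) k).

Definition normal_vec (R : realType) (m n : nat) (M : manifold R m)
    (N : manifold R n) (iota : M -> N) (g : riem_metric N) (p : M)
    (w : 'rV[R]_n) : Prop :=
  forall u : 'rV[R]_m, g (iota p) w (dmap iota p u) = 0.

Definition normal_field (R : realType) (m n : nat) (M : manifold R m)
    (N : manifold R n) (iota : M -> N) (g : riem_metric N)
    (V : M -> 'rV[R]_n) : Prop :=
  smooth_along iota V /\ forall p, normal_vec iota g p (V p).

(* The tangential part of [w] in T_(iota p)N, as a vector of T_pM: the unique
   [u] such that [w - d iota u] is normal. *)
Definition tan_part (R : realType) (m n : nat) (M : manifold R m)
    (N : manifold R n) (iota : M -> N) (g : riem_metric N) (p : M)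
    (w : 'rV[R]_n) : 'rV[R]_m :=
  xget 0 [set u | normal_vec iota g p (w - dmap iota p u)].

Definition nor_part (R : realType) (m n : nat) (M : manifold R m)
    (N : manifold R n) (iota : M -> N) (g : riem_metric N) (p : M)
    (w : 'rV[R]_n) : 'rV[R]_n :=
  w - dmap iota p (tan_part iota g p w).

(* h(X, Y) *)
Definition second_form (R : realType) (m n : nat) (M : manifold R m)
    (N : manifold R n) (iota : M -> N) (g : riem_metric N) (C : connection N)
    (X Y : M -> 'rV[R]_m) (p : M) : 'rV[R]_n :=
  nor_part iota g p (cov_along iota C X (push iota Y) p).

(* A_V X *)
Definition shape_op (R : realType) (m n : nat) (M : manifold R m)
    (N : manifold R n) (iota : M -> N) (g : riem_metric N) (C : connection N)
    (V : M -> 'rV[R]_n) (X : M -> 'rV[R]_m) (p : M) : 'rV[R]_m :=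
  - tan_part iota g p (cov_along iota C X V p).

(** * Distributions and contact CR-submanifolds *)

Definition smooth_distribution (R : realType) (m : nat) (M : manifold R m)
    (D : M -> {vspace 'rV[R]_m}) : Prop :=
  forall p, exists (r : nat) (U : set M) (E : 'I_r -> M -> 'rV[R]_m),
    [/\ open U, U p,
        (forall q i, U q -> smooth_vf_at (E i) q) &
        (forall q, U q -> basis_of (D q) [seq E i q | i : 'I_r])].

Definition orth_distribution (R : realType) (m n : nat) (M : manifold R m)
    (N : manifold R n) (iota : M -> N) (g : riem_metric N)
    (D : M -> {vspace 'rV[R]_m}) (p : M) : set 'rV[R]_m :=
  [set v | forall u, u \in D p -> induced iota g p u v = 0].

(* Gamma(D), for D a family of subsets of the tangent spaces. *)
Definition sections (R : realType) (m : nat) (M : manifold R m)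
    (D : M -> set 'rV[R]_m) : set (M -> 'rV[R]_m) :=
  [set X | smooth_vf X /\ forall p, D p (X p)].

(* With D^perp defined as the orthogonal complement of D, TM is the direct sum
   of D and D^perp. *)
Record contact_CR (R : realType) (m n : nat) (M : manifold R m)
    (N : manifold R n) (iota : M -> N) (g : riem_metric N)
    (phi : tensor11 N) (xi : N -> 'rV[R]_n)
    (D : M -> {vspace 'rV[R]_m}) : Prop := ContactCR {
  cr_distribution : smooth_distribution D;
  cr_xi : exists2 X, sections (fun p => [set` D p]) X &
    forall p, push iota X p = xi (iota p);
  cr_invariant : forall p u, u \in D p ->
    exists2 w, w \in D p & phi (iota p) (dmap iota p u) = dmap iota p w;
  cr_antiinvariant : forall p u, orth_distribution iota g D p u ->
    normal_vec iota g p (phi (iota p) (dmap iota p u))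
}.

Definition mixed_totally_geodesic (R : realType) (m n : nat)
    (M : manifold R m) (N : manifold R n) (iota : M -> N) (g : riem_metric N)
    (C : connection N) (D : M -> {vspace 'rV[R]_m}) : Prop :=
  forall X Y, sections (fun p => [set` D p]) X ->
    sections (orth_distribution iota g D) Y ->
    forall p, second_form iota g C X Y p = 0.

(* Main.v *)
Require Import Defs.
From HB Require Import structures.
From mathcomp Require Import all_boot all_order all_algebra.
From mathcomp Require Import all_classical all_reals all_analysis.
From mathcomp Require Import lra.

Set Implicit Arguments.
Unset Strict Implicit.
Unset Printing Implicit Defensive.

Import Order.TTheory GRing.Theory Num.Theory numFieldNormedType.Exports.
Local Open Scope classical_set_scope.
Local Open Scope ring_scope.

(** The two sides of the equivalence are compared through a third condition:
    the distribution orthogonal to [D] has no section other than zero.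

    Mixed total geodesy says that [h (X, Y)] vanishes for [X] in [D] and [Y]
    orthogonal to [D], while the operator [A_V] of the same connection is
    adjoint to [h*], not to [h].  What links them is the Reeb field [xi].  It is
    a section of [D], and the normal part of both [nabla_Y xi] and
    [nabla*_Y xi] has inner product [g (phi Y) (phi Y)] with [phi Y]
    ([ip_nabla_xi_phi], [ip_dual_nabla_xi_phi]), where [phi Y] is normal for
    every section [Y] of the orthogonal distribution.

    If [h (xi, Y) = 0], the symmetry of the second fundamental form
    ([cov_along_torsion]) turns this into [phi Y = 0], and then [Y = 0], as [Y]
    is orthogonal to [xi] ([trivial_orth_of_mixed]).  If the operators
    [A_V] preserve the two distributions, then taking [V = phi Y] gives
    [0 = g (A_V Y) xi = g (phi Y) (nabla*_Y xi)], and again [Y = 0]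
    ([trivial_orth_of_shape]).

    Conversely, when every section orthogonal to [D] is zero, mixed total
    geodesy and the second condition on [A_V] only concern zero fields.  For the
    first one, [A_V X] is a smooth field ([smooth_shape_op]), its component
    orthogonal to [D] is a smooth section of the orthogonal distribution, hence
    zero, and so [A_V X] lies in [D] ([mem_distribution_of_trivial_orth]).

    The argument is symmetric in a connection and its dual, since the dual
    connection is torsion-free as well ([dual_torsion_free]).  The calculus that
    it needs is that of smooth functions in charts: composition and inverse,
    symmetry of second derivatives, independence of [cov_along] from the frame
    ([cov_along_frame]), and smoothness of orthogonal projections
    ([smooth_frame_proj]). *)

(** * Smooth functions on open sets of coordinate space *)

Section Derivatives.
Context {R : realType}.

Lemma near_eq_differentiable (V W : normedModType R) (f g : V -> W) (x : V) :
  (\near x, f x = g x) -> differentiable f x -> differentiable g x.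
Proof.
move=> fg /diff_locallyxP[fc fE].
have fx : f x = g x by exact: (nbhs_singleton fg).
suff gE : g \o shift x = cst (g x) + 'd f x +o_ (0 : V) id.
  by have dE := diff_unique fc gE; apply/diff_locallyP; rewrite dE.
apply/eqaddoP => e e0.
have fgh : \forall h \near (0 : V), f (h + x) = g (h + x).
  have : \forall y \near x, f y = g y by [].
  by rewrite (near_shift 0 x) /=; apply: filterS => h; rewrite subr0.
have /eqaddoP/(_ _ e0) fE' : f \o shift x = cst (f x) + 'd f x +o_ (0 : V) id.
  by apply/eqaddoE; rewrite funeqE => y /=; rewrite fE.
by apply: filterS2 fgh fE' => h fgh; rewrite !fctE /= fgh fx.
Qed.

Lemma rV_differentiable (V : normedModType R) n (f : V -> 'rV[R]_n) (x : V) :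
  (forall i, differentiable (fun y => f y 0 i) x) -> differentiable f x.
Proof.
move=> df.
have -> : f = \sum_(i < n) (fun y => f y 0 i *: delta_mx 0 i).
  by apply/funext => y; rewrite fct_sumE [LHS]row_sum_delta.
by apply: differentiable_sum => i; exact: differentiableZl.
Qed.

Lemma derive_sum_delta (W : normedModType R) n (f : 'rV[R]_n -> W) x v :
  differentiable f x ->
  'D_v f x = \sum_(i < n) v 0 i *: 'D_(delta_mx 0 i) f x.
Proof.
move=> df; rewrite deriveE // {1}[v]row_sum_delta linear_sum.
by apply: eq_bigr => i _; rewrite linearZ deriveE.
Qed.

Lemma derive_comp (U V W : normedModType R) (f : U -> V) (g : V -> W) x v :
  differentiable f x -> differentiable g (f x) ->
  'D_v (fun y => g (f y)) x = 'D_('D_v f x) g (f x).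
Proof.
move=> df dg; rewrite (deriveE _ df) (deriveE _ dg).
rewrite (_ : (fun y => _) = g \o f) // deriveE; first by rewrite diff_comp.
exact: differentiable_comp.
Qed.

Lemma derive_coord (V : normedModType R) n (f : V -> 'rV[R]_n) x v i :
  differentiable f x -> 'D_v f x 0 i = 'D_v (fun y => f y 0 i) x.
Proof. by move=> df; rewrite derive_mx ?mxE //; exact: diff_derivable. Qed.

Lemma derive_lin (V W : normedModType R) (f : V -> W) x a u v :
  differentiable f x -> 'D_(a *: u + v) f x = a *: 'D_u f x + 'D_v f x.
Proof. by move=> df; rewrite !deriveE // linearP. Qed.

End Derivatives.

Lemma near_ex_open (T : topologicalType) (x : T) (P : T -> Prop) :
  (\forall y \near x, P y) ->
  exists U, [/\ open U, U x & forall y, U y -> P y].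
Proof. by rewrite -nbhs_nearE nbhsE => -[U [oU Ux] UP]; exists U. Qed.

Lemma near_and (T : topologicalType) (x : T) (P Q : T -> Prop) :
  (\forall y \near x, P y) -> (\forall y \near x, Q y) ->
  \forall y \near x, P y /\ Q y.
Proof. exact: filterI. Qed.

Section Smooth.
Context {R : realType}.

Section Ck.
Variables (n : nat) (O : set 'rV[R]_n).
Hypothesis oO : open O.

Lemma near_open (P : 'rV[R]_n -> Prop) x :
  (forall y, O y -> P y) -> O x -> \forall y \near x, P y.
Proof. by move=> PO Ox; apply: filterS (open_nbhs_nbhs (conj oO Ox)). Qed.

Lemma eq_Ck k f g : (forall x, O x -> f x = g x) -> Ck k O f -> Ck k O g.
Proof.
elim: k f g => [|k IHk] f g fg /=.
  move=> fc x Ox; have fgx : \near x, f x = g x by exact: near_open.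
  change (g y @[y --> x] --> g x); rewrite -(fg _ Ox).
  exact: cvg_trans (near_eq_cvg fgx) (fc x Ox).
move=> [df ddf]; split=> [x Ox|i].
  by apply: near_eq_differentiable (df x Ox); exact: near_open.
apply: IHk (ddf i) => x Ox; apply: near_eq_derive; exact: near_open.
Qed.

Lemma CkW k f : Ck k.+1 O f -> Ck k O f.
Proof.
elim: k f => [|k IHk] f [df ddf] /=.
  by move=> x Ox; apply: differentiable_continuous; exact: df.
by split=> // i; exact: IHk (ddf i).
Qed.

Lemma Ck_cst k c : Ck k O (cst c).
Proof.
elim: k c => [|k IHk] c /=; first by move=> x _; exact: cst_continuous.
split=> [x _|i]; first exact: differentiable_cst.
by apply: eq_Ck (IHk 0) => x _ /=; rewrite derive_cst.
Qed.

Lemma Ck_coord k i : Ck k O (fun x => x 0 i).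
Proof.
case: k => [|k]; first by move=> x _; exact: coord_continuous.
split=> [x _|j]; first exact: differentiable_coord.
apply: (eq_Ck _ (Ck_cst k ((delta_mx 0 j : 'rV[R]_n) 0 i))) => x _ /=.
by rewrite -(@derive_coord _ _ _ id) ?derive_id.
Qed.

Lemma CkD k f g : Ck k O f -> Ck k O g -> Ck k O (fun x => f x + g x).
Proof.
elim: k f g => [|k IHk] f g.
  by move=> fc gc x Ox; apply: continuousD; [exact: fc|exact: gc].
move=> [df ddf] [dg ddg]; split=> [x Ox|i].
  by apply: differentiableD; [exact: df|exact: dg].
apply: eq_Ck (IHk _ _ (ddf i) (ddg i)) => x Ox /=.
by rewrite deriveD //; apply: diff_derivable; [exact: df|exact: dg].
Qed.

Lemma CkM k f g : Ck k O f -> Ck k O g -> Ck k O (fun x => f x * g x).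
Proof.
elim: k f g => [|k IHk] f g.
  by move=> fc gc x Ox; apply: continuousM; [exact: fc|exact: gc].
move=> cf cg; have [cf' cg'] := (CkW cf, CkW cg).
case: cf cg => [df ddf] [dg ddg]; split=> [x Ox|i].
  by apply: differentiableM; [exact: df|exact: dg].
apply: eq_Ck (CkD (IHk _ _ cf' (ddg i)) (IHk _ _ cg' (ddf i))) => x Ox /=.
by rewrite deriveM //; apply: diff_derivable; [exact: df|exact: dg].
Qed.

Lemma Ck_sum k (I : Type) (r : seq I) (F : I -> 'rV[R]_n -> R) :
  (forall i, Ck k O (F i)) -> Ck k O (fun x => \sum_(i <- r) F i x).
Proof.
move=> cF; elim: r => [|i r IHr].
  by apply: (eq_Ck _ (Ck_cst k 0)) => x _; rewrite big_nil.
by apply: eq_Ck (CkD (cF i) IHr) => x _; rewrite big_cons.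
Qed.

(** Induction on [k], since the derivative of [1 / f] is [- (1 / f)^2 f']. *)
Lemma CkV k f : (forall x, O x -> f x != 0) -> Ck k O f ->
  Ck k O (fun x => (f x)^-1).
Proof.
move=> f0; elim: k => [|k IHk] cf.
  by move=> x Ox; apply: continuousV; [exact: f0|exact: cf].
have cV := IHk (CkW cf); case: cf => [df ddf]; split=> [x Ox|i].
  by apply: differentiableV; [exact: df|exact: f0].
apply: eq_Ck (CkM (Ck_cst k (-1)) (CkM (CkM cV cV) (ddf i))) => x Ox /=.
rewrite deriveV ?f0 //; last by apply: diff_derivable; exact: df.
by rewrite -[_ *: _]/(_ * _) mulN1r -mulNr -expr2 exprVn.
Qed.

End Ck.

Lemma Ck_sub n k (O O' : set 'rV[R]_n) f : O' `<=` O -> Ck k O f -> Ck k O' f.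
Proof.
move=> OO; elim: k f => [|k IHk] f /= cf; first by move=> x /OO; exact: cf.
by case: cf => df ddf; split=> [x /OO|i]; [exact: df|exact: IHk].
Qed.

(** Induction on [k]: a partial derivative of [f o G] is a sum of products of
    partial derivatives of [G] with partial derivatives of [f] taken along [G].
    The extra order asked of [G] makes it differentiable, hence continuous,
    already for [k = 0]. *)
Lemma Ck_comp n m k (O : set 'rV[R]_n) (O' : set 'rV[R]_m) f G :
  open O -> open O' -> (forall x, O x -> O' (G x)) ->
  Ck k O' f -> (forall j, Ck k.+1 O (fun x => G x 0 j)) ->
  Ck k O (fun x => f (G x)).
Proof.
move=> oO oO' OO'; elim: k f => [|k IHk] f cf cG.
  move=> x Ox; apply: continuous_comp; last by apply: cf; exact: OO'.
  apply: differentiable_continuous; apply: rV_differentiable => i.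
  by case: (cG i) => + _; apply.
have dG x : O x -> differentiable G x.
  by move=> Ox; apply: rV_differentiable => i; case: (cG i) => + _; apply.
have cG' j : Ck k.+1 O (fun x => G x 0 j) by apply: CkW.
case: cf => df ddf; split=> [x Ox|i].
  by apply: differentiable_comp; [exact: dG|apply: df; exact: OO'].
apply: (@eq_Ck _ _ oO _ (fun x => \sum_(j < m)
   ('D_(delta_mx 0 i) (fun y => G y 0 j) x *
     'D_(delta_mx 0 j) f (G x)))) => [x Ox|].
  rewrite derive_comp; [|exact: dG|apply: df; exact: OO'].
  rewrite derive_sum_delta; last by apply: df; exact: OO'.
  by apply: eq_bigr => j _; rewrite derive_coord //; exact: dG.
apply: Ck_sum => // j; apply: CkM => //.
  by have [_ /(_ i)] := cG j; exact: CkW.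
exact: IHk (ddf j) cG'.
Qed.

Lemma smooth_near_eq n x (f g : 'rV[R]_n -> R) :
  (\near x, f x = g x) -> smooth_near x f -> smooth_near x g.
Proof.
move=> /near_ex_open[U [oU Ux fg]] [ O [oO Ox fO]].
exists (O `&` U); split=> [|//|k]; first exact: openI.
apply: (@eq_Ck _ _ _ _ f); first exact: openI.
  by move=> y [_ Uy]; exact: fg.
by apply: Ck_sub (fO k) => y [].
Qed.

Lemma smooth_near_near n x (f : 'rV[R]_n -> R) :
  smooth_near x f -> \forall y \near x, smooth_near y f.
Proof.
by move=> [ O [oO Ox fO]]; apply: (near_open oO) => // y Oy; exists O.
Qed.

Lemma smooth_near_diff n x (f : 'rV[R]_n -> R) :
  smooth_near x f -> differentiable f x.
Proof. by move=> [ O [oO Ox fO]]; case: (fO 1) => + _; apply. Qed.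

Lemma smooth_near_cst n (x : 'rV[R]_n) c : smooth_near x (cst c).
Proof.
exists setT; split=> // [|k]; first exact: openT.
by apply: Ck_cst; exact: openT.
Qed.

Lemma smooth_near_coord n (x : 'rV[R]_n) i : smooth_near x (fun y => y 0 i).
Proof.
exists setT; split=> // [|k]; first exact: openT.
by apply: Ck_coord; exact: openT.
Qed.

Lemma smooth_nearD n x (f g : 'rV[R]_n -> R) :
  smooth_near x f -> smooth_near x g -> smooth_near x (fun y => f y + g y).
Proof.
move=> [ O [oO Ox fO]] [U [oU Ux gU]]; exists (O `&` U); split=> // [|k].
  exact: openI.
by apply: CkD; [exact: openI| |]; [apply: Ck_sub (fO k)|apply: Ck_sub (gU k)];
  move=> ? [].
Qed.

Lemma smooth_nearM n x (f g : 'rV[R]_n -> R) :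
  smooth_near x f -> smooth_near x g -> smooth_near x (fun y => f y * g y).
Proof.
move=> [ O [oO Ox fO]] [U [oU Ux gU]]; exists (O `&` U); split=> // [|k].
  exact: openI.
by apply: CkM; [exact: openI| |]; [apply: Ck_sub (fO k)|apply: Ck_sub (gU k)];
  move=> ? [].
Qed.

Lemma smooth_nearV n x (f : 'rV[R]_n -> R) :
  f x != 0 -> smooth_near x f -> smooth_near x (fun y => (f y)^-1).
Proof.
move=> fx0 sf; have cf := differentiable_continuous (smooth_near_diff sf).
have : \forall y \near x, f y != 0.
  have f0 : nbhs (f x) [set r | r != 0].
    by apply: open_nbhs_nbhs; split=> //; exact: open_neq.
  exact: cf f0.
move=> /near_ex_open[U [oU Ux f0]]; case: sf => O [oO Ox fO].
exists (O `&` U); split=> // [|k]; first exact: openI.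
apply: CkV; first exact: openI.
  by move=> y [_ Uy]; exact: f0.
by apply: Ck_sub (fO k) => y [].
Qed.

Lemma smooth_near_derive n x (f : 'rV[R]_n -> R) i :
  smooth_near x f -> smooth_near x ('D_(delta_mx 0 i) f).
Proof.
move=> [ O [oO Ox fO]]; exists O; split=> // k.
by case: (fO k.+1) => _; apply.
Qed.

Lemma smooth_near_comp n m (x : 'rV[R]_n) (f : 'rV[R]_m -> R) G :
  smooth_near (G x) f -> (forall j, smooth_near x (fun y => G y 0 j)) ->
  smooth_near x (fun y => f (G y)).
Proof.
move=> [ O' [oO' Ox' fO']] sG.
have cG : {for x, continuous G}.
  apply: differentiable_continuous; apply: rV_differentiable => j.
  exact: smooth_near_diff.
have [U HU] := choice sG.
have : \forall y \near x, O' (G y) /\ forall j, U j y.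
  apply: filterI.
    have GO' : nbhs (G x) O' by exact: open_nbhs_nbhs.
    exact: cG GO'.
  have cU j : nbhs x (U j) by have [oU Ux _] := HU j; exact: open_nbhs_nbhs.
  exact: (filter_forall (nbhs_filter x) cU).
move=> /near_ex_open[W [oW Wx WP]]; exists W; split=> // k.
apply: (Ck_comp (O' := O')) => // [y /WP[]//|j].
by have [_ _ /(_ k.+1)] := HU j; apply: Ck_sub => y /WP[_]; apply.
Qed.

End Smooth.

(** * Symmetry of second derivatives *)

Section SymmetryOfSecondDerivatives.
Context {R : realType}.

Lemma differentiable_shift (V : normedModType R) (w x : V) :
  differentiable (fun y => y + w) x.
Proof. by apply: differentiableD => //; exact: differentiable_cst. Qed.

Lemma derive_shift_comp (V W : normedModType R) (f : V -> W) w x v :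
  differentiable f (x + w) -> 'D_v (fun y => f (y + w)) x = 'D_v f (x + w).
Proof.
move=> df; rewrite (@derive_comp _ _ _ _ (fun y => y + w) f);
  [|exact: differentiable_shift|exact: df].
rewrite (@deriveD _ _ _ id (cst w)) ?derive_id ?derive_cst ?addr0 //.
Qed.

Lemma MVT_line (V : normedModType R) (f : V -> R) (a u : V) (s : R) :
  0 < s -> (forall t, 0 <= t <= s -> differentiable f (a + t *: u)) ->
  exists2 c, 0 < c < s & f (a + s *: u) - f a = s * 'D_u f (a + c *: u).
Proof.
move=> s0 df; pose l t : V := a + t *: u.
have dl t : differentiable l t.
  apply: differentiableD; first exact: differentiable_cst.
  exact: differentiableZl.
have Dl t : 'D_1 l t = u.
  rewrite (@deriveD R R^o V (cst a) (fun t : R => t *: u)) ?derive_cst ?add0r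
    //.
    by rewrite deriveE ?diff_val ?scale1r //; exact: differentiableZl.
  by apply: diff_derivable; exact: differentiableZl.
have dfl t : 0 <= t <= s -> differentiable (fun t => f (l t)) t.
  by move=> ts; apply: differentiable_comp; [exact: dl|exact: df].
have [t||c] := @MVT R (fun t => f (l t)) (fun t => 'D_u f (l t)) 0 s s0.
- rewrite in_itv /= => /andP[t0 ts].
  have t0s : 0 <= t <= s by rewrite !ltW.
  apply: DeriveDef; first by apply: diff_derivable; exact: dfl.
  by rewrite (@derive_comp _ _ _ _ l f) ?Dl //; exact: df.
- apply: derivable_within_continuous => t; rewrite in_itv /= => t0s.
  by apply: diff_derivable; exact: dfl.
rewrite in_itv /= => c0s; rewrite /l scale0r addr0 subr0 mulrC => ->.
by exists c.
Qed.

(** The mean value theorem is used twice: along [u], for the increment of [f]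
    in the direction [v], and then along [v], for ['D_u f]. *)
Lemma second_difference (V : normedModType R) (f : V -> R) (x u v : V)
    (r s : R) :
  0 < s -> s * (`|u| + `|v|) < r ->
  (forall y, `|x - y| < r -> differentiable f y) ->
  (forall y, `|x - y| < r -> differentiable ('D_u f) y) ->
  exists2 y, `|x - y| < r &
    f (x + s *: u + s *: v) - f (x + s *: u) - (f (x + s *: v) - f x) =
    s ^+ 2 * 'D_v ('D_u f) y.
Proof.
move=> s0 sr df ddf.
have close t t' : 0 <= t <= s -> 0 <= t' <= s ->
    `|x - (x + t *: u + t' *: v)| < r.
  move=> /andP[t0 ts] /andP[t'0 t's]; apply: le_lt_trans sr.
  rewrite -addrA opprD addNKr normrN (le_trans (ler_normD _ _))//.
  rewrite !normrZ !ger0_norm // mulrDr.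
  by apply: lerD; apply: ler_wpM2r.
have s00 : 0 <= (0 : R) <= s by rewrite lexx ltW.
have sss : 0 <= s <= s by rewrite lexx ltW.
have dfv t : 0 <= t <= s -> differentiable f (x + t *: u + s *: v).
  by move=> ts; apply: df; exact: close.
have df0 t : 0 <= t <= s -> differentiable f (x + t *: u).
  move=> ts; apply: df; have := close t 0 ts s00.
  by rewrite scale0r addr0.
have dfvc t : 0 <= t <= s ->
    differentiable (fun y => f (y + s *: v)) (x + t *: u).
  move=> ts; apply: differentiable_comp; first exact: differentiable_shift.
  exact: dfv.
have [t ts|c /andP[c0 cs] ->] :=
    @MVT_line V (fun y => f (y + s *: v) - f y) x u s s0.
  by apply: differentiableB; [exact: dfvc|exact: df0].
have cs' : 0 <= c <= s by rewrite !ltW.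
rewrite (@deriveB _ _ _ (fun y => f (y + s *: v)));
  [|exact/diff_derivable/dfvc|exact/diff_derivable/df0].
rewrite derive_shift_comp; last exact: dfv.
have [t ts|d /andP[d0 ds] ->] :=
    @MVT_line V ('D_u f) (x + c *: u) v s s0.
  by apply: ddf; exact: close.
exists (x + c *: u + d *: v); first by apply: close; rewrite !ltW.
by rewrite mulrA expr2.
Qed.

(** The second difference of [f] is symmetric in the two directions, so by
    [second_difference] the two mixed derivatives agree at a pair of points as
    close to [x] as desired; continuity at [x] concludes. *)
Lemma derive_sym (V : normedModType R) (f : V -> R) (x u v : V) :
  (\forall y \near x, differentiable f y) ->
  (\forall y \near x, differentiable ('D_u f) y) ->
  (\forall y \near x, differentiable ('D_v f) y) ->
  {for x, continuous ('D_v ('D_u f))} -> {for x, continuous ('D_u ('D_v f))} ->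
  'D_v ('D_u f) x = 'D_u ('D_v f) x.
Proof.
move=> df dfu dfv cvu cuv; apply/eqP; rewrite -subr_eq0 -normr_le0.
apply/ler_addgt0Pr => e e0; rewrite add0r.
have e20 : 0 < e / 2 by rewrite divr_gt0.
have : \forall y \near x, [/\ differentiable f y, differentiable ('D_u f) y,
    differentiable ('D_v f) y, `|'D_v ('D_u f) x - 'D_v ('D_u f) y| < e / 2 &
    `|'D_u ('D_v f) x - 'D_u ('D_v f) y| < e / 2].
  have nvu : \forall y \near x, `|'D_v ('D_u f) x - 'D_v ('D_u f) y| < e / 2.
    by move/cvgrPdist_lt: cvu; apply.
  have nuv : \forall y \near x, `|'D_u ('D_v f) x - 'D_u ('D_v f) y| < e / 2.
    by move/cvgrPdist_lt: cuv; apply.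
  apply: filterS (near_and (near_and df (near_and dfu dfv)) (near_and nvu nuv)).
  by move=> y [[? [? ?]] [? ?]].
move=> /nbhs_ballP[r /= r0]; rewrite -ball_normE /= => H.
pose s := r / 2 / (`|u| + `|v| + 1).
have uv0 : 0 < `|u| + `|v| + 1 by rewrite ltr_wpDl // addr_ge0.
have s0 : 0 < s by rewrite !divr_gt0.
have sr : s * (`|u| + `|v|) < r.
  rewrite /s mulrAC ltr_pdivrMr // ltr_pM //.
  - by rewrite divr_ge0 // ltW.
  - by rewrite ltr_pdivrMr // mulr_natr mulr2n ltrDl.
  - by rewrite ltrDl.
have sr' : s * (`|v| + `|u|) < r by rewrite (addrC `|v|).
have [y|y|y xy Ey] := @second_difference V f x u v r s s0 sr.
- by move=> /H[].
- by move=> /H[].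
have [z|z|z xz Ez] := @second_difference V f x v u r s s0 sr'.
- by move=> /H[].
- by move=> /H[].
have s20 : s ^+ 2 != 0 by rewrite expf_neq0 // gt_eqF.
have cancel (A B a b c d : R) : a - b - (c - d) = s ^+ 2 * A ->
    a - c - (b - d) = s ^+ 2 * B -> A = B.
  move=> EA EB; apply: (mulfI s20); rewrite -EA -EB.
  by rewrite !opprB addrACA (addrC (- b)) -addrACA.
rewrite (addrAC x) in Ez; have yz := cancel _ _ _ _ _ _ Ey Ez.
have [_ _ _ Hy _] := H _ xy; have [_ _ _ _ Hz] := H _ xz.
have close (A B A' B' : R) : A' = B' -> `|A - A'| < e / 2 ->
    `|B - B'| < e / 2 -> `|A - B| <= e.
  move=> -> Ae; rewrite distrC => Be; rewrite -(subrKA B') (splitr e).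
  exact: le_trans (ler_normD _ _) (lerD (ltW Ae) (ltW Be)).
exact: close yz Hy Hz.
Qed.

Lemma smooth_near_derive_sym n (x : 'rV[R]_n) (f : 'rV[R]_n -> R) i j :
  smooth_near x f ->
  'D_(delta_mx 0 j) ('D_(delta_mx 0 i) f) x =
  'D_(delta_mx 0 i) ('D_(delta_mx 0 j) f) x.
Proof.
move=> sf; apply: derive_sym.
- by apply: filterS (smooth_near_near sf) => y; exact: smooth_near_diff.
- apply: filterS (smooth_near_near (smooth_near_derive i sf)) => y.
  exact: smooth_near_diff.
- apply: filterS (smooth_near_near (smooth_near_derive j sf)) => y.
  exact: smooth_near_diff.
- apply/differentiable_continuous/smooth_near_diff.
  by do 2![apply: smooth_near_derive].
- apply/differentiable_continuous/smooth_near_diff.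
  by do 2![apply: smooth_near_derive].
Qed.

End SymmetryOfSecondDerivatives.

(** The second derivatives of a vector-valued map form one symmetric family of
    vectors, which is the shape in which [cov_along_torsion] meets them. *)
Lemma hessian_vector (R : realType) m n (f : 'I_n -> 'rV[R]_m -> R) x :
  (forall k, smooth_near x (f k)) ->
  exists2 H : 'I_m -> 'I_m -> 'rV[R]_n,
    forall i j k, H i j 0 k = 'D_(delta_mx 0 j) ('D_(delta_mx 0 i) (f k)) x &
    forall i j, H i j = H j i.
Proof.
move=> sf; pose h i j k := 'D_(delta_mx 0 j) ('D_(delta_mx 0 i) (f k)) x.
have [H HE] : exists H : 'I_m -> 'I_m -> 'rV[R]_n,
    forall i j k, H i j 0 k = h i j k.
  move: h => h; exists (fun i j => \row_k h i j k) => i j k; exact: mxE.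
exists H => [i j k|i j]; first by rewrite HE.
by apply/rowP => k; rewrite !HE /h; exact: smooth_near_derive_sym (sf k).
Qed.

(** * Functions and derivatives in charts *)

Section Charts.
Context {R : realType} {n : nat} {N : manifold R n}.
Implicit Types (p q r : N) (v : 'rV[R]_n).

Local Notation dom p := (chart_dom (chart_at p)).
Local Notation cod p := (chart_cod (chart_at p)).
Local Notation crd p := (chart_coord (chart_at p)).
Local Notation prm p := (chart_param (chart_at p)).

Definition mdiff (W : normedModType R) (f : N -> W) p : Prop :=
  differentiable (fun x => f (prm p x)) (crd p p).

Lemma near_dom p q : dom p q -> \forall r \near q, dom p r.
Proof.
by move=> pq; apply: open_nbhs_nbhs; split=> //; exact: chart_dom_open.
Qed.

Lemma near_cod p q : dom p q -> \forall x \near crd p q, cod p x.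
Proof.
move=> pq; apply: open_nbhs_nbhs; split; first exact: chart_cod_open.
exact: chart_coord_cod.
Qed.

Lemma near_param p q (P : N -> Prop) : dom p q ->
  (\forall r \near q, P r) -> \forall x \near crd p q, P (prm p x).
Proof.
move=> pq Pq; have cp := chart_param_cts (chart_coord_cod pq).
have Pq' : nbhs (prm p (crd p q)) P by rewrite chart_coordK.
exact: cp Pq'.
Qed.

Lemma near_coord p q (P : 'rV[R]_n -> Prop) : dom p q ->
  (\forall x \near crd p q, P x) -> \forall r \near q, P (crd p r).
Proof. by move=> pq Px; exact: chart_coord_cts pq _ Px. Qed.

Lemma near_param_dom p q r : dom p r -> dom q r ->
  \forall x \near crd p r, cod p x /\ dom q (prm p x).
Proof.
move=> pr qr; apply: near_and; first exact: near_cod.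
by apply: near_param => //; exact: near_dom.
Qed.

Lemma smooth_transition p q r i : dom p r -> dom q r ->
  smooth_near (crd p r) (fun x => crd q (prm p x) 0 i).
Proof.
move=> pr qr; have /near_ex_open[U [oU Ur UP]] := near_param_dom pr qr.
by exists U; split=> // k; apply: Ck_sub (chart_at_compat p q i k).
Qed.

Lemma diff_transition p q r : dom p r -> dom q r ->
  differentiable (fun x => crd q (prm p x)) (crd p r).
Proof.
move=> pr qr; apply: rV_differentiable => i.
exact/smooth_near_diff/smooth_transition.
Qed.

Lemma near_transition (T : Type) (f : N -> T) p q r : dom p r -> dom q r ->
  \forall x \near crd p r, f (prm q (crd q (prm p x))) = f (prm p x).
Proof.
move=> pr qr; apply: filterS (near_param_dom pr qr) => x [_ qx].
by rewrite chart_coordK.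
Qed.

(** Smoothness and differentiability at [r] do not depend on the chart, because
    the transition maps are smooth. *)
Lemma smooth_near_chart f p q r : dom p r -> dom q r ->
  smooth_near (crd q r) (fun x => f (prm q x)) ->
  smooth_near (crd p r) (fun x => f (prm p x)).
Proof.
move=> pr qr sf; apply: smooth_near_eq (near_transition f pr qr) _.
apply: (@smooth_near_comp _ _ _ _ (fun y => f (prm q y))).
  by rewrite chart_coordK.
by move=> i; exact: smooth_transition.
Qed.

Lemma diff_chart (W : normedModType R) (f : N -> W) p q r :
  dom p r -> dom q r ->
  differentiable (fun x => f (prm q x)) (crd q r) ->
  differentiable (fun x => f (prm p x)) (crd p r).
Proof.
move=> pr qr df; apply: near_eq_differentiable (near_transition f pr qr) _.
have dg : differentiable (fun y => f (prm q y)) (crd q (prm p (crd p r))).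
  by rewrite chart_coordK.
exact: (differentiable_comp (diff_transition pr qr) dg).
Qed.

Lemma smooth_fun_near f p : smooth_fun_at f p ->
  \forall q \near p, smooth_fun_at f q.
Proof.
move=> /smooth_near_near sf; have pp := chart_at_dom p.
have nd := near_dom pp; have ns := near_coord pp sf.
apply: filterS (near_and nd ns) => q [pq sq].
by apply: smooth_near_chart sq => //; exact: chart_at_dom.
Qed.

Lemma smooth_fun_coord h p q : dom p q -> smooth_near (crd p q) h ->
  smooth_fun_at (fun r => h (crd p r)) q.
Proof.
move=> pq sh; apply: (smooth_near_chart (chart_at_dom q) pq).
apply: smooth_near_eq sh; apply: filterS (near_cod pq) => x px.
by rewrite chart_paramK.
Qed.

Lemma smooth_fun_eq f g p : (\forall q \near p, f q = g q) ->
  smooth_fun_at f p -> smooth_fun_at g p.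
Proof.
by move=> fg; apply: smooth_near_eq; exact: near_param (chart_at_dom p) fg.
Qed.

Lemma smooth_fun_mdiff f p : smooth_fun_at f p -> mdiff f p.
Proof. exact: smooth_near_diff. Qed.

Lemma smooth_fun_cst p c : smooth_fun_at (fun _ : N => c) p.
Proof. exact: smooth_near_cst. Qed.

Lemma smooth_funD f g p : smooth_fun_at f p -> smooth_fun_at g p ->
  smooth_fun_at (fun q => f q + g q) p.
Proof. exact: smooth_nearD. Qed.

Lemma smooth_funM f g p : smooth_fun_at f p -> smooth_fun_at g p ->
  smooth_fun_at (fun q => f q * g q) p.
Proof. exact: smooth_nearM. Qed.

Lemma smooth_funV f p : f p != 0 -> smooth_fun_at f p ->
  smooth_fun_at (fun q => (f q)^-1) p.
Proof.
by move=> fp; apply: smooth_nearV; rewrite chart_coordK //; exact: chart_at_dom.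
Qed.

Lemma smooth_fun_sum (I : Type) (s : seq I) (P : pred I) (F : I -> N -> R) p :
  (forall i, smooth_fun_at (F i) p) ->
  smooth_fun_at (fun q => \sum_(i <- s | P i) F i q) p.
Proof.
move=> sF; elim: s => [|i s IHs].
  by under eq_fun do rewrite big_nil; exact: smooth_fun_cst.
under eq_fun do rewrite big_cons.
by case: (P i) => //; exact: smooth_funD.
Qed.

Lemma smooth_fun_prod (I : Type) (s : seq I) (P : pred I) (F : I -> N -> R) p :
  (forall i, smooth_fun_at (F i) p) ->
  smooth_fun_at (fun q => \prod_(i <- s | P i) F i q) p.
Proof.
move=> sF; elim: s => [|i s IHs].
  by under eq_fun do rewrite big_nil; exact: smooth_fun_cst.
under eq_fun do rewrite big_cons.
by case: (P i) => //; exact: smooth_funM.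
Qed.

Lemma der_near_eq (W : normedModType R) (f g : N -> W) p v :
  (\forall q \near p, f q = g q) -> der f p v = der g p v.
Proof.
by move=> fg; apply: near_eq_derive; exact: near_param (chart_at_dom p) fg.
Qed.

Lemma der_linear (W : normedModType R) (f : N -> W) p :
  mdiff f p -> linear (der f p).
Proof. by move=> df a u v; exact: derive_lin. Qed.

Lemma der0 (W : normedModType R) (f : N -> W) p : der f p 0 = 0.
Proof. exact: derive0. Qed.

Lemma der_cst (W : normedModType R) (c : W) p v : der (fun _ : N => c) p v = 0.
Proof. exact: derive_cst. Qed.

Lemma derD f g p v : smooth_fun_at f p -> smooth_fun_at g p ->
  der (fun q => f q + g q) p v = der f p v + der g p v.
Proof.
move=> /smooth_fun_mdiff df /smooth_fun_mdiff dg.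
by rewrite /der deriveD //; exact: diff_derivable.
Qed.

Lemma derM f g p v : smooth_fun_at f p -> smooth_fun_at g p ->
  der (fun q => f q * g q) p v = der f p v * g p + f p * der g p v.
Proof.
move=> /smooth_fun_mdiff df /smooth_fun_mdiff dg.
rewrite /der deriveM; try exact: diff_derivable.
rewrite (chart_coordK (chart_at_dom p)) addrC; congr (_ + _).
exact: mulrC.
Qed.

Lemma der_sum (I : Type) (s : seq I) (F : I -> N -> R) p v :
  (forall i, smooth_fun_at (F i) p) ->
  der (fun q => \sum_(i <- s) F i q) p v = \sum_(i <- s) der (F i) p v.
Proof.
move=> sF; elim: s => [|i s IHs].
  rewrite big_nil; under [X in der X]eq_fun do rewrite big_nil.
  exact: der_cst.
under [X in der X]eq_fun do rewrite big_cons.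
by rewrite big_cons derD ?IHs //; exact: smooth_fun_sum.
Qed.

Lemma der_component m (f : N -> 'rV[R]_m) p v i :
  mdiff f p -> der f p v 0 i = der (fun q => f q 0 i) p v.
Proof. by move=> df; rewrite /der derive_coord. Qed.

Lemma mdiff_coord p q : dom p q -> mdiff (crd p) q.
Proof. by move=> pq; apply: diff_transition => //; exact: chart_at_dom. Qed.

(** [der f q] is computed in [chart_at q], a chart that varies with [q].  This
    form, with the fixed chart [chart_at p], is the one in which the dependence
    on [q] can be studied. *)
Lemma der_chart (W : normedModType R) (f : N -> W) p q v :
  mdiff f q -> dom p q ->
  der f q v = 'D_(der (crd p) q v) (fun x => f (prm p x)) (crd p q).
Proof.
move=> df pq; have qq := chart_at_dom q.
rewrite /der -(near_eq_derive _ (near_transition f qq pq)).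
rewrite (@derive_comp _ _ _ _ (fun x => crd p (prm q x))
  (fun y => f (prm p y))).
- by rewrite chart_coordK.
- exact: diff_transition.
- by rewrite chart_coordK //; exact: diff_chart df.
Qed.

Lemma der_coord_vf (W : normedModType R) (f : N -> W) p q k :
  mdiff f q -> dom p q ->
  der f q (coord_vf p k q) =
  'D_(delta_mx 0 k) (fun x => f (prm p x)) (crd p q).
Proof.
move=> df pq; have qq := chart_at_dom q.
rewrite -(near_eq_derive _ (near_transition f pq qq)).
rewrite (@derive_comp _ _ _ _ (fun x => crd q (prm p x))
  (fun y => f (prm q y))).
- by rewrite chart_coordK.
- exact: diff_transition.
- by rewrite chart_coordK.
Qed.

Lemma derive_chart_id p q v : dom p q ->
  'D_v (fun x => crd p (prm p x)) (crd p q) = v.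
Proof.
move=> pq; rewrite (@near_eq_derive _ _ _ _ id) ?derive_id //.
by apply: filterS (near_cod pq) => x px; rewrite chart_paramK.
Qed.

Lemma der_coord_self p v : der (crd p) p v = v.
Proof. by apply: derive_chart_id; exact: chart_at_dom. Qed.

Lemma coord_vf_self p k : coord_vf p k p = delta_mx 0 k.
Proof. by apply: derive_chart_id; exact: chart_at_dom. Qed.

Lemma der_coord_coord_vf p q k : dom p q ->
  der (crd p) q (coord_vf p k q) = delta_mx 0 k.
Proof.
by move=> pq; rewrite der_coord_vf ?derive_chart_id //; exact: mdiff_coord.
Qed.

(** The identity of the tangent space at [q] is the derivative of the transition
    from [chart_at q] to itself, and it can be computed through [chart_at p]. *)
Lemma coord_vf_sum p q v : dom p q ->
  v = \sum_k der (crd p) q v 0 k *: coord_vf p k q.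
Proof.
move=> pq; have qq := chart_at_dom q.
rewrite -{1}[v](der_coord_self q) (der_chart v (mdiff_coord qq) pq).
by rewrite derive_sum_delta //; exact: diff_transition.
Qed.

(** In [chart_at q] the components of the coordinate field are the partial
    derivatives of a transition map. *)
Lemma smooth_coord_vf p q k : dom p q -> smooth_vf_at (coord_vf p k) q.
Proof.
move=> pq i; have qq := chart_at_dom q.
have sq := smooth_near_derive k (smooth_transition i pq qq).
apply: smooth_fun_eq (smooth_fun_coord pq sq).
apply: filterS (near_and (near_dom pq) (near_dom qq)) => r [pr qr].
rewrite /comp_along der_coord_vf //; last exact: mdiff_coord.
by rewrite derive_coord //; exact: diff_transition.
Qed.

End Charts.

(** * Fields along a map *)

Section LinearSums.
Context {K : pzRingType} {U V : lmodType K} {f : U -> V} (lf : linear f).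

Lemma linear_fun0 : f 0 = 0.
Proof.
have := lf 1 0 0; rewrite !scale1r addr0 => h.
by apply: (addIr (f 0)); rewrite add0r -h.
Qed.

Lemma linear_funZ a u : f (a *: u) = a *: f u.
Proof. by rewrite -[a *: u]addr0 lf linear_fun0 addr0. Qed.

Lemma linear_funD u v : f (u + v) = f u + f v.
Proof. by rewrite -{1}[u]scale1r lf scale1r. Qed.

Lemma linear_funB u v : f (u - v) = f u - f v.
Proof. by rewrite linear_funD -scaleN1r linear_funZ scaleN1r. Qed.

Lemma linear_fun_sum (I : Type) (s : seq I) (P : pred I) (F : I -> U) :
  f (\sum_(i <- s | P i) F i) = \sum_(i <- s | P i) f (F i).
Proof.
elim: s => [|i s IHs]; first by rewrite !big_nil linear_fun0.
by rewrite !big_cons; case: (P i) => //; rewrite linear_funD IHs.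
Qed.

End LinearSums.

Lemma sub00 (V : zmodType) (a b : V) : a = 0 -> b = 0 -> a - b = 0.
Proof. by move=> -> ->; exact: subrr. Qed.

Lemma addrKA2 (V : zmodType) (a b s t : V) :
  a + s + t - (b + s + t) = a - b.
Proof. by rewrite opprD addrACA subrr addr0 opprD addrACA subrr addr0. Qed.

Lemma symmetric_sum (K : comPzRingType) (V : lmodType K) n (a b : 'I_n -> K)
    (c : 'I_n -> 'I_n -> V) : (forall i j, c i j = c j i) ->
  \sum_i \sum_j a i *: (b j *: c i j) = \sum_i \sum_j b i *: (a j *: c i j).
Proof.
move=> cC; rewrite exchange_big; apply: eq_bigr => i _; apply: eq_bigr => j _.
by rewrite cC !scalerA mulrC.
Qed.

Section FieldsAlongMaps.
Context {R : realType} {m n : nat} {M : manifold R m} {N : manifold R n}.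
Variables (F : M -> N).
Hypothesis sF : smooth_map F.
Implicit Types (p q : M) (V W : M -> 'rV[R]_n).

Local Notation dom p := (chart_dom (chart_at p)).
Local Notation crd p := (chart_coord (chart_at p)).
Local Notation prm p := (chart_param (chart_at p)).

Lemma near_near (T : topologicalType) (x : T) (P : T -> Prop) :
  (\forall y \near x, P y) -> \forall y \near x, \forall z \near y, P z.
Proof.
move=> /near_ex_open[U [oU Ux UP]].
have : nbhs x U by exact: open_nbhs_nbhs.
by apply: filterS => y Uy; apply: (filterS UP); exact: open_nbhs_nbhs.
Qed.

Lemma near_map p (P : N -> Prop) : (\forall r \near F p, P r) ->
  \forall q \near p, P (F q).
Proof. by case: sF => cF _; exact: cF. Qed.

Lemma near_map_dom p : \forall q \near p, dom (F p) (F q).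
Proof. by apply: near_map; apply: near_dom; exact: chart_at_dom. Qed.

Lemma mdiff_coord_map p : mdiff (fun q => crd (F p) (F q)) p.
Proof.
by apply: rV_differentiable => i; apply: smooth_near_diff; case: sF => _; exact.
Qed.

Lemma near_coord_map (T : Type) (f : N -> T) p :
  \forall x \near crd p p,
    f (prm (F p) (crd (F p) (F (prm p x)))) = f (F (prm p x)).
Proof.
apply: filterS (near_param (chart_at_dom p) (near_map_dom p)) => x Fx.
by rewrite chart_coordK.
Qed.

Lemma smooth_fun_comp f p : smooth_fun_at f (F p) ->
  smooth_fun_at (fun q => f (F q)) p.
Proof.
move=> sf; apply: smooth_near_eq (near_coord_map f p) _.
apply: (@smooth_near_comp _ _ _ _ (fun y => f (prm (F p) y))) => [|i].
  by rewrite (chart_coordK (chart_at_dom p)).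
by case: sF => _; exact.
Qed.

Lemma der_map (W : normedModType R) (f : N -> W) p v : mdiff f (F p) ->
  der (fun q => f (F q)) p v = der f (F p) (dmap F p v).
Proof.
move=> df; have pp := chart_coordK (chart_at_dom p).
rewrite /der -(near_eq_derive _ (near_coord_map f p)).
rewrite (@derive_comp _ _ _ _ (fun x => crd (F p) (F (prm p x)))
  (fun y => f (prm (F p) y))) ?pp //; exact: mdiff_coord_map.
Qed.

Lemma dmap_linear p : linear (dmap F p).
Proof. exact: der_linear (mdiff_coord_map p). Qed.

Lemma comp_along_self W p : comp_along F W p p = W p.
Proof. exact: der_coord_self. Qed.

Lemma near_comp_alongE W p : \forall q \near p,
  W q = \sum_k comp_along F W p q 0 k *: coord_vf (F p) k (F q).
Proof. by apply: filterS (near_map_dom p) => q; exact: coord_vf_sum. Qed.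

Lemma smooth_along_eq V W p : (\forall q \near p, V q = W q) ->
  smooth_along_at F V p -> smooth_along_at F W p.
Proof.
move=> VW sV i; apply: smooth_fun_eq (sV i).
by apply: filterS VW => q; rewrite /comp_along => ->.
Qed.

Lemma smooth_alongD V W p : smooth_along_at F V p -> smooth_along_at F W p ->
  smooth_along_at F (fun q => V q + W q) p.
Proof.
move=> sV sW i; apply: smooth_fun_eq (smooth_funD (sV i) (sW i)).
apply: filterS (near_map_dom p) => q Fq.
by rewrite /comp_along (linear_funD (der_linear (mdiff_coord Fq))) mxE.
Qed.

Lemma smooth_alongZ a W p : smooth_fun_at a p -> smooth_along_at F W p ->
  smooth_along_at F (fun q => a q *: W q) p.
Proof.
move=> sa sW i; apply: smooth_fun_eq (smooth_funM sa (sW i)).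
apply: filterS (near_map_dom p) => q Fq.
by rewrite /comp_along (linear_funZ (der_linear (mdiff_coord Fq))) mxE.
Qed.

Lemma smooth_along0 p : smooth_along_at F (fun=> 0) p.
Proof.
move=> i; apply: smooth_fun_eq (smooth_fun_cst p 0).
by apply: filterE => q; rewrite /comp_along der0 mxE.
Qed.

Lemma smooth_along_sum (I : Type) (s : seq I) (G : I -> M -> 'rV[R]_n) p :
  (forall i, smooth_along_at F (G i) p) ->
  smooth_along_at F (fun q => \sum_(i <- s) G i q) p.
Proof.
move=> sG; elim: s => [|i s IHs].
  apply: smooth_along_eq (smooth_along0 p).
  by apply: filterE => q; rewrite big_nil.
apply: smooth_along_eq (smooth_alongD (sG i) IHs).
by apply: filterE => q; rewrite big_cons.
Qed.

Lemma smooth_along_pull (E : N -> 'rV[R]_n) p : smooth_vf_at E (F p) ->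
  smooth_along_at F (fun q => E (F q)) p.
Proof. by move=> sE i; exact: smooth_fun_comp (sE i). Qed.

(** Near [p], [der f q (X q)] is the sum of the components of [X] times the
    partial derivatives of [f], all in the chart at [p]. *)
Lemma smooth_der f X p : smooth_fun_at f p -> smooth_vf_at X p ->
  smooth_fun_at (fun q => der f q (X q)) p.
Proof.
move=> sf sX; have pp := chart_at_dom p.
have : smooth_fun_at (fun q => \sum_k (comp_along id X p q 0 k *
    'D_(delta_mx 0 k) (fun x => f (prm p x)) (crd p q))) p.
  apply: smooth_fun_sum => k; apply: smooth_funM; first exact: sX.
  exact: smooth_fun_coord pp (smooth_near_derive k sf).
apply: smooth_fun_eq.
apply: filterS (near_and (near_dom pp) (smooth_fun_near sf)).
move=> q [pq /smooth_fun_mdiff df]; rewrite (der_chart _ df pq).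
by rewrite derive_sum_delta //; apply: diff_chart df => //; exact: chart_at_dom.
Qed.

(** The components of a pushed field are derivatives of the coordinates of
    [F], by the chain rule. *)
Lemma near_comp_push X p : \forall q \near p,
  comp_along F (push F X) p q = der (fun q => crd (F p) (F q)) q (X q).
Proof.
apply: filterS (near_map_dom p) => q Fq.
by rewrite der_map //; exact: mdiff_coord.
Qed.

Lemma near_mdiff_coord_map p : \forall q \near p,
  mdiff (fun q => crd (F p) (F q)) q.
Proof.
have sc i : smooth_fun_at (fun q => crd (F p) (F q) 0 i) p.
  by case: sF => _; exact.
have := filter_forall (nbhs_filter p) (fun i => smooth_fun_near (sc i)).
apply: filterS => q sq; apply: rV_differentiable => i.
exact/smooth_near_diff/sq.
Qed.

Lemma smooth_push X p : smooth_vf_at X p -> smooth_along_at F (push F X) p.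
Proof.
move=> sX i; have sc : smooth_fun_at (fun q => crd (F p) (F q) 0 i) p.
  by case: sF => _; exact.
apply: smooth_fun_eq (smooth_der sc sX).
apply: filterS (near_and (near_comp_push X p) (near_mdiff_coord_map p)).
by move=> q [-> dq]; rewrite der_component.
Qed.

Lemma smooth_tensor_along (phi : tensor11 N) W p : smooth_along_at F W p ->
  smooth_along_at F (fun q => phi (F q) (W q)) p.
Proof.
move=> sW; have : smooth_along_at F (fun q => \sum_k comp_along F W p q 0 k *:
    phi (F q) (coord_vf (F p) k (F q))) p.
  apply: smooth_along_sum => k; apply: smooth_alongZ; first exact: sW.
  apply: (smooth_along_pull (E := fun r => phi r (coord_vf (F p) k r))).
  by apply: t11_smooth; apply: smooth_coord_vf; exact: chart_at_dom.
apply: smooth_along_eq; apply: filterS (near_comp_alongE W p) => q Wq.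
rewrite [in RHS]Wq (linear_fun_sum (t11_lin phi (F q))); apply: eq_bigr => k _.
by rewrite (linear_funZ (t11_lin phi (F q))).
Qed.

End FieldsAlongMaps.

Section MetricAlongMaps.
Context {R : realType} {n : nat} {N : manifold R n} (g : riem_metric N).
Implicit Type p : N.

Lemma ip_linl p w : linear (fun v => g p v w : R^o).
Proof. exact: ip_lin. Qed.

Lemma ip_linr p v : linear (fun w => g p v w : R^o).
Proof. by move=> a u w; rewrite !(ip_sym g p v); exact: ip_lin. Qed.

Lemma ip_eq0 p v : g p v v = 0 -> v = 0.
Proof. by apply: contra_eq => /(ip_pos g p)/lt0r_neq0. Qed.

Lemma ip_inj p u v : (forall w, g p u w = g p v w) -> u = v.
Proof.
move=> uv; apply/eqP; rewrite -subr_eq0; apply/eqP; apply: (@ip_eq0 p).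
by rewrite (linear_funB (ip_linl p _)) uv subrr.
Qed.

Lemma smooth_ip_along m (M : manifold R m) (F : M -> N) V W (p : M) :
  smooth_map F -> smooth_along_at F V p -> smooth_along_at F W p ->
  smooth_fun_at (fun q => g (F q) (V q) (W q)) p.
Proof.
move=> sF sV sW; have : smooth_fun_at (fun q => \sum_k \sum_l
    comp_along F V p q 0 k * (comp_along F W p q 0 l *
      g (F q) (coord_vf (F p) k (F q)) (coord_vf (F p) l (F q)))) p.
  apply: smooth_fun_sum => k; apply: smooth_fun_sum => l.
  apply: smooth_funM; first exact: sV.
  apply: smooth_funM; first exact: sW.
  apply: (smooth_fun_comp sF
    (f := fun r => g r (coord_vf (F p) k r) (coord_vf (F p) l r))).
  by apply: ip_smooth; apply: smooth_coord_vf; exact: chart_at_dom.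
apply: smooth_fun_eq.
apply: filterS (near_and (near_comp_alongE sF V p) (near_comp_alongE sF W p)).
move=> q [Vq Wq]; rewrite [in RHS]Vq [in RHS]Wq.
rewrite (linear_fun_sum (ip_linl _ _)); apply: eq_bigr => k _.
rewrite (linear_funZ (ip_linl _ _)) (linear_fun_sum (ip_linr _ _)).
rewrite scaler_sumr; apply: eq_bigr => l _.
by rewrite (linear_funZ (ip_linr _ _)).
Qed.

End MetricAlongMaps.

Lemma smooth_map_id (R : realType) n (N : manifold R n) :
  smooth_map (id : N -> N).
Proof.
split=> [p|p i]; first exact: cvg_id.
apply: (smooth_fun_coord (chart_at_dom p) (h := fun x => x 0 i)).
exact: smooth_near_coord.
Qed.

(** * Connections and derivatives along a map *)

Section VectorFields.
Context {R : realType} {n : nat} {N : manifold R n}.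
Implicit Types (p : N) (X Y : N -> 'rV[R]_n).

Lemma smooth_vf0 p : smooth_vf_at (fun _ : N => 0) p.
Proof. exact: smooth_along0. Qed.

Lemma smooth_vfD X Y p : smooth_vf_at X p -> smooth_vf_at Y p ->
  smooth_vf_at (fun q => X q + Y q) p.
Proof. exact: (smooth_alongD (smooth_map_id N)). Qed.

Lemma smooth_vfZ a X p : smooth_fun_at a p -> smooth_vf_at X p ->
  smooth_vf_at (fun q => a q *: X q) p.
Proof. exact: (smooth_alongZ (smooth_map_id N)). Qed.

Lemma smooth_vf_sum (I : Type) (s : seq I) (G : I -> N -> 'rV[R]_n) p :
  (forall i, smooth_vf_at (G i) p) ->
  smooth_vf_at (fun q => \sum_(i <- s) G i q) p.
Proof. exact: (smooth_along_sum (smooth_map_id N)). Qed.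

Lemma exists_local_extension p v :
  exists2 Z : N -> 'rV[R]_n, smooth_vf_at Z p & Z p = v.
Proof.
exists (fun q => \sum_k v 0 k *: coord_vf p k q).
  apply: smooth_vf_sum => k; apply: smooth_vfZ; first exact: smooth_fun_cst.
  by apply: smooth_coord_vf; exact: chart_at_dom.
by rewrite [RHS]row_sum_delta; apply: eq_bigr => k _; rewrite coord_vf_self.
Qed.

End VectorFields.

Section Connections.
Context {R : realType} {n : nat} {N : manifold R n} (C : connection N).
Implicit Types (p q : N) (X Y Z : N -> 'rV[R]_n).

(** A connection only sees germs.  The indicator function [f] of the set where
    [Y] and [Z] agree is constant near [p], hence smooth there, and [f Y = f Z]
    everywhere; the Leibniz rule does the rest. *)
Lemma nabla_near_eq p v Y Z : smooth_vf_at Y p -> smooth_vf_at Z p ->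
  (\forall q \near p, Y q = Z q) -> C p v Y = C p v Z.
Proof.
move=> sY sZ YZ; have YZp : Y p = Z p by exact: (nbhs_singleton YZ).
pose f q : R := if `[< Y q = Z q >] then 1 else 0.
have f1 : \forall q \near p, 1 = f q.
  by apply: filterS YZ => q Yq; rewrite /f asboolT.
have sf : smooth_fun_at f p by apply: smooth_fun_eq f1 (smooth_fun_cst p 1).
have fYZ : (fun q => f q *: Y q) = (fun q => f q *: Z q).
  by apply/funext => q; rewrite /f; case: asboolP => [->//|_]; rewrite !scale0r.
have := nabla_leibniz C v sf sY; rewrite fYZ (nabla_leibniz C v sf sZ) YZp.
by move=> /addrI; rewrite -(nbhs_singleton f1) !scale1r.
Qed.

Lemma nabla0 p v : C p v (fun=> 0) = 0.
Proof.
have s0 := smooth_vf0 p.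
have := nablaD C v s0 s0; under eq_fun do rewrite addr0.
by move=> h; apply: (addIr (C p v (fun=> 0))); rewrite add0r -h.
Qed.

Lemma nabla_sum (I : Type) (s : seq I) (G : I -> N -> 'rV[R]_n) p v :
  (forall i, smooth_vf_at (G i) p) ->
  C p v (fun q => \sum_(i <- s) G i q) = \sum_(i <- s) C p v (G i).
Proof.
move=> sG; elim: s => [|i s IHs].
  by under eq_fun do rewrite big_nil; rewrite big_nil nabla0.
under eq_fun do rewrite big_cons.
by rewrite (nablaD _ _ (sG i) (smooth_vf_sum s sG)) IHs big_cons.
Qed.

Lemma nabla_coordE p v Y : smooth_vf_at Y p ->
  C p v Y = \sum_j (der (fun q => comp_along id Y p q 0 j) p v *: coord_vf p j p
                    + Y p 0 j *: C p v (coord_vf p j)).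
Proof.
move=> sY; have se j := smooth_coord_vf j (chart_at_dom p).
have sZ j : smooth_vf_at (fun q => comp_along id Y p q 0 j *: coord_vf p j q) p.
  exact: smooth_vfZ (sY j) (se j).
have sS := smooth_vf_sum (index_enum _) sZ.
rewrite (nabla_near_eq v sY sS (near_comp_alongE (smooth_map_id N) Y p)).
rewrite (nabla_sum _ _ sZ); apply: eq_bigr => j _.
by rewrite (nabla_leibniz C v (sY j) (se j)) comp_along_self.
Qed.

(** Coordinate fields of one chart have constant components in it, so their
    bracket vanishes and torsion-freeness is the symmetry of the Christoffel
    symbols. *)
Lemma coord_vf_symmetric p k l : torsion_free C ->
  C p (coord_vf p k p) (coord_vf p l) = C p (coord_vf p l p) (coord_vf p k).
Proof.
move=> tC; have pp := chart_at_dom p.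
have nconst h v : der (comp_along id (coord_vf p h) p) p v = 0.
  rewrite -(der_cst (delta_mx 0 h : 'rV[R]_n) p v); apply: der_near_eq.
  by apply: filterS (near_dom pp) => q pq; exact: der_coord_coord_vf.
apply/eqP; rewrite -subr_eq0; apply/eqP.
have /= := tC p _ _ (smooth_coord_vf k pp) (smooth_coord_vf l pp).
rewrite /cov => ->; rewrite /lie_bracket.
exact: (sub00 (nconst l (coord_vf p k p)) (nconst k (coord_vf p l p))).
Qed.

End Connections.

Section CovariantDerivativeAlong.
Context {R : realType} {m n : nat} {M : manifold R m} {N : manifold R n}.
Variables (F : M -> N).
Hypothesis sF : smooth_map F.
Variable C : connection N.
Implicit Types (p q : M) (X : M -> 'rV[R]_m) (V W : M -> 'rV[R]_n).

Local Notation dom p := (chart_dom (chart_at p)).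

(** [cov_along] is defined through the coordinate frame of the chart at [F p],
    a frame that changes with [p].  Any local fields in which [W] decomposes
    give the same result; this is what makes [cov_along] comparable at nearby
    points, and computable on restrictions of fields of [N]. *)
Lemma cov_along_frame (r : nat) (w : 'I_r -> M -> R) (E : 'I_r -> N -> 'rV[R]_n)
    X W p :
  (forall k, smooth_fun_at (w k) p) -> (forall k, smooth_vf_at (E k) (F p)) ->
  (\forall q \near p, W q = \sum_k w k q *: E k (F q)) ->
  cov_along F C X W p =
  \sum_k (der (w k) p (X p) *: E k (F p)
          + w k p *: C (F p) (push F X p) (E k)).
Proof.
move=> sw sE WE; have Wp := nbhs_singleton WE.
pose a k j r := comp_along id (E k) (F p) r 0 j.
have sa k j : smooth_fun_at (a k j) (F p) by exact: sE.
have saF k j := smooth_fun_comp sF (sa k j).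
have swa k j := smooth_funM (sw k) (saF k j).
have cE j : \forall q \near p,
    \sum_k w k q * a k j (F q) = comp_along F W p q 0 j.
  apply: filterS (near_and WE (near_map_dom sF p)) => q [Wq Fq].
  rewrite /comp_along Wq (linear_fun_sum (der_linear (mdiff_coord Fq))).
  rewrite summxE; apply: eq_bigr => k _.
  by rewrite (linear_funZ (der_linear (mdiff_coord Fq))) mxE.
have sc j : smooth_fun_at (fun q => comp_along F W p q 0 j) p.
  by apply: smooth_fun_eq (cE j) _; exact: smooth_fun_sum.
have dc : mdiff (comp_along F W p) p.
  by apply: rV_differentiable => j; exact/smooth_near_diff/sc.
pose u := push F X p.
have derc : der (comp_along F W p) p (X p) = \sum_j (\sum_k
    (der (w k) p (X p) * E k (F p) 0 j + w k p * der (a k j) (F p) u))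
    *: coord_vf (F p) j (F p).
  rewrite [LHS]row_sum_delta; apply: eq_bigr => j _.
  rewrite coord_vf_self (der_component _ _ dc) -(der_near_eq _ (cE j)).
  rewrite (der_sum _ _ (swa^~ j)); congr (_ *: _); apply: eq_bigr => k _.
  rewrite (derM _ (sw k) (saF k j)) (der_map sF _ (smooth_fun_mdiff (sa k j))).
  by rewrite /a comp_along_self.
rewrite /cov_along derc -/u -big_split /=.
under [RHS]eq_bigr => k _ do
  rewrite [E k (F p)]row_sum_delta (nabla_coordE C u (sE k)) !scaler_sumr
    -big_split /=.
rewrite [RHS]exchange_big /=; apply: eq_bigr => j _.
rewrite !scaler_suml Wp summxE scaler_suml -big_split /=.
apply: eq_bigr => k _; rewrite coord_vf_self mxE scalerDl scalerDr !scalerA.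
by rewrite -addrA.
Qed.

(** Near [p] the formula of [cov_along_frame] is applied with the coordinate
    frame at [F p], fixed once for all; every term is then visibly smooth. *)
Lemma smooth_cov_along X V p : smooth_vf_at X p -> smooth_along_at F V p ->
  smooth_along_at F (cov_along F C X V) p.
Proof.
move=> sX sV; pose e k := coord_vf (F p) k.
pose w k q := comp_along F V p q 0 k.
pose x l q := comp_along F (push F X) p q 0 l.
have se k : smooth_vf_at (e k) (F p).
  by apply: smooth_coord_vf; exact: chart_at_dom.
have sx l : smooth_fun_at (x l) p by exact: (smooth_push sF sX).
have : smooth_along_at F (fun q => \sum_k (der (w k) q (X q) *: e k (F q)
    + w k q *: \sum_l x l q *: C (F q) (e l (F q)) (e k))) p.
  apply: (smooth_along_sum sF) => k; apply: (smooth_alongD sF).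
    apply: (smooth_alongZ sF); first exact: smooth_der (sV k) sX.
    exact: (smooth_along_pull sF).
  apply: (smooth_alongZ sF); first exact: sV.
  apply: (smooth_along_sum sF) => l; apply: (smooth_alongZ sF); first exact: sx.
  apply: (smooth_along_pull sF (E := fun r => C r (e l r) (e k))).
  exact: nabla_smooth.
apply: smooth_along_eq.
have nw := filter_forall (nbhs_filter p) (fun k => smooth_fun_near (sV k)).
have nV := near_near (near_comp_alongE sF V p).
have nX := near_comp_alongE sF (push F X) p.
apply: filterS (near_and (near_and (near_map_dom sF p) nw) (near_and nV nX)).
move=> q [[Fq swq] [Vq Xq]].
have seq k : smooth_vf_at (e k) (F q) by exact: smooth_coord_vf.
rewrite (@cov_along_frame _ w e X V q swq seq Vq); apply: eq_bigr => k _.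
congr (_ + _ *: _); rewrite Xq (linear_fun_sum (nabla_lin C (seq k))).
by apply: eq_bigr => l _; rewrite (linear_funZ (nabla_lin C (seq k))).
Qed.

Lemma cov_along_pull X (Z : N -> 'rV[R]_n) p : smooth_vf_at Z (F p) ->
  cov_along F C X (fun q => Z (F q)) p = C (F p) (push F X p) Z.
Proof.
move=> sZ; rewrite (@cov_along_frame 1 (fun _ _ => 1) (fun=> Z)) //.
- by rewrite big_ord1 der_cst scale0r add0r scale1r.
- by move=> _; exact: smooth_fun_cst.
- by apply: filterE => q; rewrite big_ord1 scale1r.
Qed.

Lemma cov_along_zero X p : cov_along F C X (fun=> 0) p = 0.
Proof.
by rewrite (@cov_along_pull X (fun=> 0)) ?nabla0 //; exact: smooth_vf0.
Qed.

Lemma cov_along_zerol W p : cov_along F C (fun=> 0) W p = 0.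
Proof.
rewrite /cov_along der0 add0r big1 // => k _.
rewrite /push (linear_fun0 (dmap_linear sF p)).
have se := smooth_coord_vf k (chart_at_dom (F p)).
by rewrite (linear_fun0 (nabla_lin C se)) scaler0.
Qed.

(** This is the symmetry of the second fundamental form.  In charts, the
    derivative along [X] of [push F Y] has three terms: the image by [dmap F] of
    the derivative of the components of [Y], the second derivative of [F] on the
    pair [(X, Y)], and a Christoffel term.  The last two are symmetric in [X]
    and [Y], so only tangent vectors remain in the difference. *)
Lemma cov_along_torsion X Y p : torsion_free C ->
  smooth_vf_at X p -> smooth_vf_at Y p ->
  exists u, cov_along F C X (push F Y) p - cov_along F C Y (push F X) p =
            dmap F p u.
Proof.
move=> tC sX sY; pose c q := chart_coord (chart_at (F p)) (F q).
pose x0 := chart_coord (chart_at p) p; pose P := F p.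
pose f k x : R := c (chart_param (chart_at p) x) 0 k.
have sc k : smooth_fun_at (fun q => c q 0 k) p by case: sF => _ /(_ p k).
have sf k : smooth_near x0 (f k) by exact: sc.
have [H HE Hsym] := hessian_vector sf.
have derP (Z : M -> 'rV[R]_m) v : smooth_vf_at Z p ->
    der (comp_along F (push F Z) p) p v =
    dmap F p (der (comp_along id Z p) p v)
    + \sum_i \sum_j Z p 0 i *: (v 0 j *: H i j).
  move=> sZ; apply/rowP => k.
  pose z i q := comp_along id Z p q 0 i.
  pose dc i q := 'D_(delta_mx 0 i) (f k) (chart_coord (chart_at p) q).
  have sdc i : smooth_fun_at (dc i) p.
    exact: smooth_fun_coord (chart_at_dom p) (smooth_near_derive i (sf k)).
  have sz i : smooth_fun_at (z i) p by exact: sZ.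
  have zdc : \forall q \near p,
      comp_along F (push F Z) p q 0 k = \sum_i z i q * dc i q.
    have nd := near_dom (chart_at_dom p).
    apply: filterS (near_and (near_and nd (near_comp_push sF Z p))
      (near_and (near_mdiff_coord_map sF p) (smooth_fun_near (sc k)))).
    move=> q [[pq ->] [dq /smooth_fun_mdiff sq]].
    rewrite (der_component _ _ dq) (der_chart _ sq pq).
    have qq := chart_at_dom q.
    exact: (derive_sum_delta _ (diff_chart pq qq sq)).
  have dpush : mdiff (comp_along F (push F Z) p) p.
    apply: rV_differentiable => i.
    exact: (smooth_near_diff (smooth_push sF sZ i)).
  have dz : mdiff (comp_along id Z p) p.
    by apply: rV_differentiable => i; exact: smooth_near_diff (sz i).
  rewrite (der_component _ _ dpush) (der_near_eq _ zdc).
  rewrite (der_sum _ _ (fun i => smooth_funM (sz i) (sdc i))).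
  have entZ a (B : 'rV[R]_n) : (a *: B) 0 k = a * B 0 k by rewrite mxE.
  have derc w : der (fun q => c q 0 k) p w = \sum_i w 0 i *: dc i p.
    exact: derive_sum_delta (smooth_near_diff (sf k)).
  have derdc i w : der (dc i) p w = \sum_j w 0 j * H i j 0 k.
    rewrite /der derive_sum_delta; last exact: smooth_near_diff (sdc i).
    have dcE : \forall x \near x0,
        dc i (chart_param (chart_at p) x) = 'D_(delta_mx 0 i) (f k) x.
      apply: filterS (near_cod (chart_at_dom p)) => x xp.
      by rewrite /dc chart_paramK.
    by apply: eq_bigr => j _; rewrite (HE i j k) (near_eq_derive _ dcE).
  rewrite mxE [dmap F p _ 0 k](der_component _ _ (mdiff_coord_map sF p)).
  rewrite derc summxE -big_split /=; apply: eq_bigr => i _.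
  rewrite (derM _ (sz i) (sdc i)) (der_component _ _ dz) derdc.
  congr (_ + _); rewrite summxE {1}/z comp_along_self mulr_sumr.
  by apply: eq_bigr => j _; rewrite (entZ (Z p 0 i)) (entZ (v 0 j)).
have se k := smooth_coord_vf k (chart_at_dom P).
have Csum (Z W : M -> 'rV[R]_m) :
    \sum_k push F W p 0 k *: C P (push F Z p) (coord_vf P k) =
    \sum_k \sum_l push F W p 0 k *:
      (push F Z p 0 l *: C P (coord_vf P l P) (coord_vf P k)).
  apply: eq_bigr => k _; rewrite -scaler_sumr; congr (_ *: _).
  rewrite {1}[push F Z p]row_sum_delta (linear_fun_sum (nabla_lin C (se k))).
  apply: eq_bigr => l _; rewrite (linear_funZ (nabla_lin C (se k))).
  by rewrite coord_vf_self.
pose S (Z W : M -> 'rV[R]_m) : 'rV[R]_n :=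
  \sum_i \sum_j W p 0 i *: (Z p 0 j *: H i j).
pose T (Z W : M -> 'rV[R]_m) : 'rV[R]_n := \sum_k \sum_l push F W p 0 k *:
  (push F Z p 0 l *: C P (coord_vf P l P) (coord_vf P k)).
pose d (Z W : M -> 'rV[R]_m) : 'rV[R]_m := der (comp_along id W p) p (Z p).
have covE (Z W : M -> 'rV[R]_m) : smooth_vf_at W p ->
    cov_along F C Z (push F W) p = dmap F p (d Z W) + S Z W + T Z W.
  by move=> sW; congr (_ + _); [exact: derP|exact: Csum].
have S_sym (Z W : M -> 'rV[R]_m) : S Z W = S W Z.
  exact: (symmetric_sum (W p 0) (Z p 0) Hsym).
have T_sym (Z W : M -> 'rV[R]_m) : T Z W = T W Z.
  exact: (symmetric_sum (push F W p 0) (push F Z p 0)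
    (fun k l => coord_vf_symmetric P l k tC)).
exists (d X Y - d Y X); rewrite (linear_funB (dmap_linear sF p)).
rewrite (covE _ _ sX) (covE _ _ sY) S_sym T_sym.
exact: addrKA2.
Qed.

(** Decompose [V] in the coordinate frame [e k] at [F p]: the duality of the two
    connections differentiates each [g (e k) Z], and [cov_along_frame] collects
    the terms. *)
Lemma cov_along_dual (g : riem_metric N) (Cs : connection N) X V
    (Z : N -> 'rV[R]_n) p :
  dual_connection g C Cs -> smooth_along_at F V p -> smooth_vf_at Z (F p) ->
  der (fun q => g (F q) (V q) (Z (F q))) p (X p) =
  g (F p) (cov_along F C X V p) (Z (F p))
  + g (F p) (V p) (Cs (F p) (push F X p) Z).
Proof.
move=> CCs sV sZ; pose e k := coord_vf (F p) k.
pose w k q := comp_along F V p q 0 k; pose u := push F X p.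
have se k : smooth_vf_at (e k) (F p).
  by apply: smooth_coord_vf; exact: chart_at_dom.
pose G k r := g r (e k r) (Z r).
have sG k : smooth_fun_at (G k) (F p) by exact: (ip_smooth g (se k) sZ).
have sw k : smooth_fun_at (w k) p by exact: sV.
have sGF k := smooth_fun_comp sF (sG k).
have VE := near_comp_alongE sF V p; have Vp := nbhs_singleton VE.
have [U sU Up] := exists_local_extension (F p) u.
have derG k : der (G k) (F p) u = g (F p) (C (F p) u (e k)) (Z (F p))
    + g (F p) (e k (F p)) (Cs (F p) u Z).
  by have := CCs _ _ _ _ sU (se k) sZ; rewrite /cov Up.
rewrite (@der_near_eq _ _ _ _ _ (fun q => \sum_k w k q * G k (F q)));
  last first.
  apply: filterS VE => q ->; rewrite (linear_fun_sum (ip_linl g _ _)).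
  by apply: eq_bigr => k _; rewrite (linear_funZ (ip_linl g _ _)).
rewrite (der_sum _ _ (fun k => smooth_funM (sw k) (sGF k))).
rewrite (@cov_along_frame _ w e X V p sw se VE) Vp.
rewrite !(linear_fun_sum (ip_linl g _ _)) -big_split /=; apply: eq_bigr => k _.
rewrite (derM _ (sw k) (sGF k)) (der_map sF _ (smooth_fun_mdiff (sG k))).
rewrite -/(push F X p) -/u derG (linear_funD (ip_linl g _ _)).
rewrite !(linear_funZ (ip_linl g _ _)) -addrA; congr (_ + _).
by rewrite mulrDr.
Qed.

End CovariantDerivativeAlong.

(** * Orthogonal projections *)

Section SmoothMatrices.
Context {R : realType} {m : nat} {M : manifold R m}.

Lemma smooth_fun_det r (A : M -> 'M[R]_r) p :
  (forall i j, smooth_fun_at (fun q => A q i j) p) ->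
  smooth_fun_at (fun q => \det (A q)) p.
Proof.
move=> sA; apply: smooth_fun_sum => s; apply: smooth_funM.
  exact: smooth_fun_cst.
by apply: smooth_fun_prod => i; exact: sA.
Qed.

Lemma smooth_fun_invmx r (A : M -> 'M[R]_r) p i j :
  (\forall q \near p, A q \in unitmx) ->
  (forall i j, smooth_fun_at (fun q => A q i j) p) ->
  smooth_fun_at (fun q => invmx (A q) i j) p.
Proof.
move=> uA sA; have Ap := nbhs_singleton uA.
have : smooth_fun_at (fun q => (\det (A q))^-1 * cofactor (A q) j i) p.
  apply: smooth_funM.
    apply: smooth_funV; first by rewrite -unitfE -unitmxE.
    exact: smooth_fun_det.
  apply: smooth_funM; first exact: smooth_fun_cst.
  apply: smooth_fun_det => k l; apply: smooth_fun_eq (sA (lift j k) (lift i l)).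
  by apply: filterE => q; rewrite !mxE.
apply: smooth_fun_eq; apply: filterS uA => q Aq.
by rewrite /invmx Aq !mxE.
Qed.

End SmoothMatrices.

Lemma basis_of_ord (K : fieldType) (V : vectType K) r (e : 'I_r -> V)
    (U : {vspace V}) : basis_of U [seq e i | i : 'I_r] ->
  [/\ forall c : 'rV[K]_r, \sum_i c 0 i *: e i = 0 -> c = 0,
      forall i, e i \in U &
      forall u, u \in U -> exists c : 'rV[K]_r, u = \sum_i c 0 i *: e i].
Proof.
have sz : size [seq e i | i : 'I_r] == r by rewrite size_map size_enum_ord.
pose X := Tuple sz; have XE (i : 'I_r) : X`_i = e i.
  by rewrite /= (nth_map i) ?size_enum_ord // nth_ord_enum.
move=> bX; have bX' : basis_of U X by [].
split=> [c c0|i|u uU].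
- have /freeP/(_ (c 0)) fX := basis_free bX'.
  apply/rowP => i; rewrite [RHS]mxE; apply: fX.
  by rewrite -[RHS]c0; apply: eq_bigr => j _; rewrite XE.
- by apply: (basis_mem bX); rewrite map_f // mem_enum.
- exists (\row_i coord X i u); rewrite [LHS](coord_basis bX' uU).
  by apply: eq_bigr => i _; rewrite mxE XE.
Qed.

Section TangentialProjection.
Context {R : realType} {m n : nat} {M : manifold R m} {N : manifold R n}.
Variables (F : M -> N) (g : riem_metric N).
Hypothesis subF : submanifold F.
Implicit Types (p q : M) (u v : 'rV[R]_m) (w : 'rV[R]_n).

Let sF : smooth_map F := sub_smooth subF.

Lemma induced_eq0 p u : Defs.induced F g p u u = 0 -> u = 0.
Proof.
move=> /ip_eq0 u0; apply: (sub_immersion subF (p := p)).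
by rewrite u0 (linear_fun0 (dmap_linear sF p)).
Qed.

Definition gram r (e : 'I_r -> 'rV[R]_m) p : 'M[R]_r :=
  \matrix_(i, j) Defs.induced F g p (e i) (e j).

(** The orthogonal projection onto the span of the [e i], whose coefficients
    solve the normal equations of the Gram matrix. *)
Definition frame_proj r (e : 'I_r -> 'rV[R]_m) p w : 'rV[R]_m :=
  \sum_i ((\row_j g (F p) w (dmap F p (e j))) *m invmx (gram e p)) 0 i *: e i.

Lemma ip_dmap_sum r (e : 'I_r -> 'rV[R]_m) p (c : 'rV[R]_r) w :
  g (F p) (dmap F p (\sum_i c 0 i *: e i)) w =
  \sum_i c 0 i * g (F p) (dmap F p (e i)) w.
Proof.
rewrite (linear_fun_sum (dmap_linear sF p)) (linear_fun_sum (ip_linl g _ _)).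
apply: eq_bigr => i _.
by rewrite (linear_funZ (dmap_linear sF p)) (linear_funZ (ip_linl g _ _)).
Qed.

(** A row vector killed by the Gram matrix is the coefficient vector of a
    combination of the [e i] that is orthogonal to itself. *)
Lemma gram_unit r (e : 'I_r -> 'rV[R]_m) p :
  (forall c : 'rV[R]_r, \sum_i c 0 i *: e i = 0 -> c = 0) ->
  gram e p \in unitmx.
Proof.
move=> ie; rewrite -row_free_unit -kermx_eq0; apply/rowV0P => c /sub_kermxP cG.
apply: ie; apply: (@induced_eq0 p).
rewrite /Defs.induced ip_dmap_sum big1 // => i _.
rewrite ip_sym ip_dmap_sum.
suff -> : \sum_j c 0 j * g (F p) (dmap F p (e j)) (dmap F p (e i)) = 0.
  by rewrite mulr0.
have /rowP/(_ i) := cG; rewrite mxE [RHS]mxE => cGi; rewrite -[RHS]cGi.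
by apply: eq_bigr => j _; rewrite mxE.
Qed.

Lemma frame_projP r (e : 'I_r -> 'rV[R]_m) p w i :
  (forall c : 'rV[R]_r, \sum_i c 0 i *: e i = 0 -> c = 0) ->
  g (F p) (w - dmap F p (frame_proj e p w)) (dmap F p (e i)) = 0.
Proof.
move=> /(@gram_unit _ _ p) uG; rewrite (linear_funB (ip_linl g _ _)).
rewrite ip_dmap_sum.
set b := \row_j _; set c := b *m _.
have /rowP/(_ i) : c *m gram e p = b by rewrite mulmxKV.
rewrite [LHS]mxE [RHS]mxE => <-; apply/eqP; rewrite subr_eq0; apply/eqP.
by apply: eq_bigr => j _; rewrite [gram e p j i]mxE.
Qed.

(** By Cramer's rule the entries of the inverse Gram matrix are rational
    functions of the inner products of the frame, with a nonvanishing
    denominator. *)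
Lemma smooth_frame_proj r (E : 'I_r -> M -> 'rV[R]_m) (W : M -> 'rV[R]_n) p :
  (forall i, smooth_vf_at (E i) p) -> smooth_along_at F W p ->
  (\forall q \near p, forall c : 'rV[R]_r,
      \sum_i c 0 i *: E i q = 0 -> c = 0) ->
  smooth_vf_at (fun q => frame_proj (E^~ q) q (W q)) p.
Proof.
move=> sE sW iE; apply: smooth_vf_sum => i; apply: smooth_vfZ (sE i).
have : smooth_fun_at (fun q => \sum_j g (F q) (W q) (dmap F q (E j q)) *
    invmx (gram (E^~ q) q) j i) p.
  apply: smooth_fun_sum => j; apply: smooth_funM.
    exact: (smooth_ip_along g sF sW (smooth_push sF (sE j))).
  apply: smooth_fun_invmx.
    by apply: filterS iE => q; exact: gram_unit.
  move=> k l; have sg := smooth_ip_along g sF (smooth_push sF (sE k))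
    (smooth_push sF (sE l)).
  by apply: smooth_fun_eq sg; apply: filterE => q; rewrite mxE.
apply: smooth_fun_eq; apply: filterE => q; rewrite [RHS]mxE.
by apply: eq_bigr => j _; rewrite [in RHS]mxE.
Qed.

Lemma coord_vf_indep p q (c : 'rV[R]_m) : chart_dom (chart_at p) q ->
  \sum_i c 0 i *: coord_vf p i q = 0 -> c = 0.
Proof.
move=> pq c0; have lc := der_linear (mdiff_coord pq).
have := linear_fun0 lc; rewrite -[X in der _ _ X]c0 (linear_fun_sum lc) => lc0.
rewrite [c]row_sum_delta -[RHS]lc0; apply: eq_bigr => i _.
by rewrite (linear_funZ lc) (der_coord_coord_vf _ pq).
Qed.

Lemma normal_vec0 p u : normal_vec F g p (dmap F p u) -> u = 0.
Proof. by move=> /(_ u) /induced_eq0. Qed.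

Lemma tan_part_unique p w u : normal_vec F g p (w - dmap F p u) ->
  tan_part F g p w = u.
Proof.
move=> nu; rewrite /tan_part; case: xgetP => [v _ nv|/(_ u)//].
apply/eqP; rewrite -subr_eq0; apply/eqP; apply: (@normal_vec0 p) => x.
have -> : dmap F p (v - u) = (w - dmap F p u) - (w - dmap F p v).
  by rewrite (linear_funB (dmap_linear sF p)) opprB [RHS]addrC subrKA.
rewrite (linear_funB (ip_linl g _ _)); exact: (sub00 (nu x) (nv x)).
Qed.

Lemma frame_proj_coord p q w : chart_dom (chart_at p) q ->
  normal_vec F g q (w - dmap F q (frame_proj (fun i => coord_vf p i q) q w)).
Proof.
move=> pq u; rewrite [u](coord_vf_sum u pq) ip_sym ip_dmap_sum big1 // => i _.
rewrite ip_sym frame_projP ?mulr0 // => c; exact: coord_vf_indep.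
Qed.

Lemma tan_partP p w : normal_vec F g p (w - dmap F p (tan_part F g p w)).
Proof.
have np := frame_proj_coord w (chart_at_dom p).
by rewrite (tan_part_unique np).
Qed.

(** Near [p] the tangential part is the projection onto the coordinate frame of
    the chart at [p]. *)
Lemma smooth_tan_part (W : M -> 'rV[R]_n) p : smooth_along_at F W p ->
  smooth_vf_at (fun q => tan_part F g q (W q)) p.
Proof.
move=> sW; have pp := chart_at_dom p.
have iE : \forall q \near p, forall c : 'rV[R]_m,
    \sum_i c 0 i *: coord_vf p i q = 0 -> c = 0.
  by apply: filterS (near_dom pp) => q pq c; exact: coord_vf_indep.
have := smooth_frame_proj (fun i => smooth_coord_vf i pp) sW iE.
apply: (smooth_along_eq (F := id)).
apply: filterS (near_dom pp) => q pq.
by apply/esym/tan_part_unique; exact: frame_proj_coord.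
Qed.

Lemma smooth_shape_op (C : connection N) (V : M -> 'rV[R]_n)
    (X : M -> 'rV[R]_m) :
  smooth_along F V -> smooth_vf X -> smooth_vf (shape_op F g C V X).
Proof.
move=> sV sX p.
have st := smooth_tan_part (smooth_cov_along sF C (sX p) (sV p)).
apply: smooth_along_eq (smooth_vfZ (smooth_fun_cst p (-1)) st).
by apply: filterE => q; rewrite scaleN1r.
Qed.

Variable D : M -> {vspace 'rV[R]_m}.
Hypothesis sD : smooth_distribution D.

Lemma induced_lin p u : linear (fun v => Defs.induced F g p u v : R^o).
Proof.
by move=> a v w; rewrite /Defs.induced (dmap_linear sF p) (ip_linr g).
Qed.

Lemma orth_proj_unique p u d d' : d \in D p -> d' \in D p ->
  orth_distribution F g D p (u - d) -> orth_distribution F g D p (u - d') ->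
  d = d'.
Proof.
move=> dD d'D ud ud'; apply/eqP; rewrite -subr_eq0; apply/eqP.
apply: (@induced_eq0 p); have dd' : d - d' \in D p by rewrite rpredB.
have -> : Defs.induced F g p (d - d') (d - d') =
    Defs.induced F g p (d - d') ((u - d') - (u - d)).
  by congr (Defs.induced F g p _ _); rewrite opprB [RHS]addrC subrKA.
by rewrite (linear_funB (induced_lin p _)) (ud _ dd') (ud' _ dd'); exact: subrr.
Qed.

Lemma frame_proj_orth r (e : 'I_r -> 'rV[R]_m) p u :
  basis_of (D p) [seq e i | i : 'I_r] ->
  frame_proj e p (dmap F p u) \in D p /\
  orth_distribution F g D p (u - frame_proj e p (dmap F p u)).
Proof.
move=> /basis_of_ord[ie eD De]; split=> [|v /De[c ->]].
  by apply: rpred_sum => i _; exact: rpredZ.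
rewrite /Defs.induced ip_dmap_sum big1 // => i _.
rewrite (linear_funB (dmap_linear sF p)) ip_sym frame_projP ?mulr0 //.
Qed.

(** The component of [X] orthogonal to [D] is a smooth section of the orthogonal
    distribution, as local frames of [D] show; so it vanishes. *)
Lemma mem_distribution_of_trivial_orth (X : M -> 'rV[R]_m) :
  (forall Y, sections (orth_distribution F g D) Y -> forall p, Y p = 0) ->
  smooth_vf X -> forall p, X p \in D p.
Proof.
move=> D0 sX.
have /choice[d dP] : forall p, exists d, d \in D p /\
    orth_distribution F g D p (X p - d).
  move=> p; have [r [U [E [_ Up _ bE]]]] := sD p.
  exists (frame_proj (E^~ p) p (dmap F p (X p))).
  exact: frame_proj_orth (bE p Up).
have sY : smooth_vf (fun q => X q - d q).
  move=> p; have [r [U [E [oU Up sE bE]]]] := sD p.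
  have nU : \forall q \near p, U q by exact: open_nbhs_nbhs.
  have iE : \forall q \near p, forall c : 'rV[R]_r,
      \sum_i c 0 i *: E i q = 0 -> c = 0.
    by apply: filterS nU => q /bE/basis_of_ord[].
  have sd := smooth_frame_proj (sE p ^~ Up) (smooth_push sF (sX p)) iE.
  apply: smooth_along_eq (smooth_vfD (sX p)
    (smooth_vfZ (smooth_fun_cst p (-1)) sd)).
  apply: filterS nU => q Uq; rewrite scaleN1r; congr (_ - _).
  have [fD fo] := frame_proj_orth (X q) (bE q Uq).
  by have [dD od] := dP q; exact: orth_proj_unique fD dD fo od.
have sec : sections (orth_distribution F g D) (fun q => X q - d q).
  by split=> // p; case: (dP p).
move=> p; have /eqP := D0 _ sec p; rewrite subr_eq0 => /eqP ->.
by case: (dP p).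
Qed.

End TangentialProjection.

(** * Sasakian statistical manifolds and contact CR-submanifolds *)

Section SasakianStatistical.
Context {R : realType} {n : nat} {N : manifold R n} (g : riem_metric N).
Implicit Types (p : N) (v : 'rV[R]_n).

Lemma dual_connection_sym (C Cs : connection N) :
  dual_connection g C Cs -> dual_connection g Cs C.
Proof.
move=> CCs p X Y Z sX sY sZ.
have -> : (fun q => g q (Y q) (Z q)) = (fun q => g q (Z q) (Y q)).
  by apply/funext => q; rewrite ip_sym.
by rewrite (CCs p X Z Y sX sZ sY) addrC ip_sym [X in _ + X = _]ip_sym.
Qed.

(** Writing the metric derivatives in the Codazzi equation by duality leaves
    [g (nabla*_X Y - nabla*_Y X) Z = g (nabla_X Y - nabla_Y X) Z]. *)
Lemma dual_torsion_free (C Cs : connection N) :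
  statistical g C -> dual_connection g C Cs -> torsion_free Cs.
Proof.
move=> [tC codazzi] CCs p X Y sX sY; rewrite -(tC p X Y sX sY).
apply: (ip_inj (g := g) (p := p)) => w.
have [Z sZ <-] := exists_local_extension p w.
have := codazzi p X Y Z sX sY sZ; rewrite /cov_metric.
rewrite (dual_connection_sym CCs sX sY sZ) (dual_connection_sym CCs sY sX sZ).
rewrite !(linear_funB (ip_linl g p _)).
set a := g p (cov C X Y p) _; set a' := g p (cov C Y X p) _.
set b := g p (cov Cs X Y p) _; set b' := g p (cov Cs Y X p) _.
set c := g p (Y p) _; set c' := g p (X p) _.
clearbody a a' b b' c c' => h.
have {}h : b - a = b' - a' by move: h; lra.
lra.
Qed.

Variables (phi : tensor11 N) (xi : N -> 'rV[R]_n) (eta : one_form N).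

Section AlmostContact.
Hypothesis acm : almost_contact_metric g phi xi eta.

Lemma phi_xi p : phi p (xi p) = 0.
Proof.
apply: (@ip_eq0 _ _ _ g p); rewrite (acm_phi_ip acm) -(acm_eta acm).
by rewrite (acm_xi_unit acm) mulr1 subrr.
Qed.

(** Expanding [phi^3 v] in two ways gives [eta (phi v) xi = phi (eta v xi)],
    and the right-hand side is zero. *)
Lemma ip_phi_xi p v : g p (phi p v) (xi p) = 0.
Proof.
have := acm_phi2 acm p (phi p v).
rewrite (acm_phi2 acm p v) (linear_funD (t11_lin phi p)).
rewrite (linear_funZ (t11_lin phi p)) phi_xi scaler0 addr0.
rewrite -[- v]scaleN1r (linear_funZ (t11_lin phi p)) scaleN1r (acm_eta acm).
rewrite -[X in X = _]addr0 => /addrI/esym eta_xi0.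
have := linear_funZ (ip_linl g p (xi p)) (eta p (phi p v)) (xi p).
rewrite eta_xi0 (linear_fun0 (ip_linl g p _)) (acm_xi_unit acm) => h.
exact: etrans (esym (mulr1 _)) (esym h).
Qed.

Lemma phi_eq0_parallel p v : phi p v = 0 -> v = eta p v *: xi p.
Proof.
move=> pv; have := acm_phi2 acm p v.
rewrite pv (linear_fun0 (t11_lin phi p)) => /esym/eqP.
by rewrite addrC subr_eq0 => /eqP.
Qed.

Lemma phi_eq0_orth p v : phi p v = 0 -> g p v (xi p) = 0 -> v = 0.
Proof.
move=> /phi_eq0_parallel vE; rewrite (acm_eta acm) => v0.
by rewrite vE v0 scale0r.
Qed.

End AlmostContact.

Section Reeb.
Variables (C L : connection N).
Hypothesis sas : sasakian_statistical g C L phi xi eta.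

Let acm := sas_acm sas.

(** The difference of [C p v xi] and [phi v] is [K (v, xi)].  As [phi xi = 0],
    the compatibility of [K] with [phi] says that [phi] kills it, so it is a
    multiple of [xi] and is orthogonal to [phi v]. *)
Lemma ip_nabla_xi_phi p v :
  g p (C p v xi) (phi p v) = g p (phi p v) (phi p v).
Proof.
have [X sX Xp] := exists_local_extension p v; have sxi := acm_xi_smooth acm p.
pose k := diff_tensor C L X xi p.
have k0 : phi p k = 0.
  have := sas_K sas sX sxi; rewrite /diff_tensor /cov.
  have -> : (fun q => phi q (xi q)) = fun=> 0.
    by apply/funext => q; exact: phi_xi.
  by rewrite !nabla0 subrr add0r.
have CE : C p v xi = phi p v + k.
  by rewrite -Xp -(sas_xi sas sX) addrC subrK.
rewrite CE (linear_funD (ip_linl g p _)) (phi_eq0_parallel acm k0).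
rewrite (linear_funZ (ip_linl g p _)) [g p (xi p) _]ip_sym (ip_phi_xi acm).
by rewrite scaler0 addr0.
Qed.

(** The function [g (phi X) xi] is identically zero.  Differentiating it with
    the dual pair and with the Levi-Civita connection, the discrepancy is
    [g (K (X, phi X)) xi = - g (phi (K (X, X))) xi = 0]. *)
Lemma ip_dual_nabla_xi_phi (Cs : connection N) p v : dual_connection g C Cs ->
  g p (Cs p v xi) (phi p v) = g p (phi p v) (phi p v).
Proof.
move=> CCs; have [X sX Xp] := exists_local_extension p v.
have sxi := acm_xi_smooth acm p.
have sphi := t11_smooth phi sX.
have := CCs p X _ _ sX sphi sxi.
have [_ /(_ p X _ _ sX sphi sxi)] := sas_levi_civita sas.
rewrite /cov_metric.
have -> : (fun q => g q (phi q (X q)) (xi q)) = fun=> 0.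
  by apply/funext => q; exact: ip_phi_xi.
rewrite der_cst (sas_xi sas sX) /cov Xp.
have kE : g p (C p v (fun q => phi q (X q))) (xi p) =
          g p (L p v (fun q => phi q (X q))) (xi p).
  apply/eqP; rewrite -subr_eq0 -(linear_funB (ip_linl g p _)) -Xp.
  have /eqP := sas_K sas sX sX; rewrite addr_eq0 => /eqP.
  rewrite /diff_tensor /cov => ->; rewrite -scaleN1r.
  by rewrite (linear_funZ (ip_linl g p _)) (ip_phi_xi acm) scaler0.
rewrite kE [g p (phi p v) (Cs p v xi)]ip_sym.
set a := g p (L _ _ _) _; set b := g p (phi p v) _; set c := g p (Cs _ _ _) _.
by clearbody a b c => h1 h2; lra.
Qed.

End Reeb.

End SasakianStatistical.

Section MixedTotallyGeodesic.
Context {R : realType} {n m : nat} {N : manifold R n} {M : manifold R m}.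
Variables (g : riem_metric N) (phi : tensor11 N) (xi : N -> 'rV[R]_n).
Variables (eta : one_form N) (iota : M -> N) (D : M -> {vspace 'rV[R]_m}).
Hypothesis acm : almost_contact_metric g phi xi eta.
Hypothesis subM : submanifold iota.
Hypothesis CR : contact_CR iota g phi xi D.

Let si : smooth_map iota := sub_smooth subM.

Local Notation secD := (sections (fun p => [set` D p])).
Local Notation Dperp := (orth_distribution iota g D).

(** [phi] is injective on the orthogonal complement of [xi], and [D] contains
    [xi]. *)
Lemma orth_phi_eq0 p u : Dperp p u ->
  phi (iota p) (dmap iota p u) = 0 -> u = 0.
Proof.
move=> Du phi0; have [X [_ XD] Xxi] := cr_xi CR.
apply: (sub_immersion subM (p := p)); rewrite (linear_fun0 (dmap_linear si p)).
apply: (phi_eq0_orth acm phi0); rewrite -Xxi ip_sym.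
exact: Du _ (XD p).
Qed.

Lemma tan_part_dmap p u : tan_part iota g p (dmap iota p u) = u.
Proof.
apply: (tan_part_unique subM) => x.
by rewrite subrr (linear_fun0 (ip_linl g _ _)).
Qed.

Lemma tan_part0 p : tan_part iota g p 0 = 0.
Proof. by rewrite -{1}(linear_fun0 (dmap_linear si p)) tan_part_dmap. Qed.

Lemma ip_dmap_tan_part p u w :
  g (iota p) (dmap iota p u) (dmap iota p (tan_part iota g p w)) =
  g (iota p) w (dmap iota p u).
Proof.
have nw : normal_vec iota g p (w - dmap iota p (tan_part iota g p w)).
  exact: tan_partP.
have := nw u; rewrite (linear_funB (ip_linl g _ _)).
by move=> /eqP; rewrite subr_eq0 => /eqP ->; rewrite ip_sym.
Qed.

Lemma phi_push_normal (Y : M -> 'rV[R]_m) : sections Dperp Y ->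
  normal_field iota g (fun q => phi (iota q) (push iota Y q)).
Proof.
move=> [sY DY]; split=> p; last exact: cr_antiinvariant CR _ _ (DY p).
exact: smooth_tensor_along si _ _ _ (smooth_push si (sY p)).
Qed.

Variables (C Cs : connection N).
Hypothesis CCs : dual_connection g C Cs.
Hypothesis tC : torsion_free C.
Hypothesis C_xi : forall p v,
  g p (C p v xi) (phi p v) = g p (phi p v) (phi p v).
Hypothesis Cs_xi : forall p v,
  g p (Cs p v xi) (phi p v) = g p (phi p v) (phi p v).

Let trivial_orth := forall Y, sections Dperp Y -> forall p, Y p = 0.

(** If [h (xi, Y) = 0] then [nabla_Y xi] is tangent, by the symmetry of [h];
    but its inner product with the normal vector [phi Y] is the square of the
    norm of [phi Y]. *)
Lemma trivial_orth_of_mixed : mixed_totally_geodesic iota g C D -> trivial_orth.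
Proof.
move=> mixed Y secY p; have [sY DY] := secY.
have [X secX Xxi] := cr_xi CR; have [sX _] := secX.
apply: orth_phi_eq0 (DY p) _; apply: (@ip_eq0 _ _ _ g (iota p)).
have [u uE] := cov_along_torsion si tC (sX p) (sY p).
have pushX : push iota X = fun q => xi (iota q) by apply/funext.
have := mixed X Y secX secY p; rewrite /second_form /nor_part.
set w := cov_along _ _ _ _ _ in uE *; set t := tan_part _ _ _ _ => /eqP.
rewrite subr_eq0 => /eqP wt; rewrite -C_xi -/(push iota Y p).
rewrite -(cov_along_pull si C Y (acm_xi_smooth acm (iota p))) -pushX.
have -> : cov_along iota C Y (push iota X) p = dmap iota p (t - u).
  by rewrite (linear_funB (dmap_linear si p)) -uE -wt opprB addrC subrK.
by rewrite ip_sym; exact: cr_antiinvariant CR _ _ (DY p) _.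
Qed.

Lemma mixed_of_trivial_orth : trivial_orth -> mixed_totally_geodesic iota g C D.
Proof.
move=> triv X Y _ secY p.
have -> : Y = fun=> 0 by apply/funext; exact: triv.
rewrite /second_form /nor_part.
have -> : push iota (fun=> 0) = fun=> 0.
  by apply/funext => q; exact: linear_fun0 (dmap_linear si q).
rewrite (cov_along_zero si) tan_part0 (linear_fun0 (dmap_linear si p)).
exact: subrr.
Qed.

(** For [V = phi Y], the product [g V xi] is identically zero, so by duality
    [g (A_V Y) xi = g V (nabla*_Y xi)], the square of the norm of [phi Y].  The
    left-hand side is zero when [A_V Y] is orthogonal to [D]. *)
Lemma trivial_orth_of_shape :
  (forall V, normal_field iota g V -> forall X, sections Dperp X ->
     sections Dperp (shape_op iota g C V X)) -> trivial_orth.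
Proof.
move=> shape Y secY p; have [sY DY] := secY.
have [X [_ XD] Xxi] := cr_xi CR.
apply: orth_phi_eq0 (DY p) _; apply: (@ip_eq0 _ _ _ g (iota p)).
pose V q := phi (iota q) (push iota Y q).
have nV : normal_field iota g V := phi_push_normal secY.
have [_ /(_ p _ (XD p))] := shape V nV Y secY.
rewrite /Defs.induced /shape_op -scaleN1r (linear_funZ (dmap_linear si p)).
rewrite (linear_funZ (ip_linr g _ _)) ip_dmap_tan_part -/(push iota X p) Xxi.
move=> CV0; have sV := nV.1 p.
have {}CV0 : g (iota p) (cov_along iota C Y V p) (xi (iota p)) = 0.
  by apply/eqP; move/eqP: CV0; rewrite scaleN1r oppr_eq0.
have := cov_along_dual si Y CCs sV (acm_xi_smooth acm (iota p)).
have -> : (fun q => g (iota q) (V q) (xi (iota q))) = fun=> 0.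
  by apply/funext => q; exact: ip_phi_xi acm _ _.
rewrite der_cst CV0 add0r => /esym E.
by rewrite -Cs_xi ip_sym; exact: E.
Qed.

Lemma shape_of_trivial_orth : trivial_orth ->
  forall V, normal_field iota g V ->
    (forall X, secD X -> secD (shape_op iota g C V X)) /\
    (forall X, sections Dperp X -> sections Dperp (shape_op iota g C V X)).
Proof.
move=> triv V [sV _]; split=> X secX.
  have sA := smooth_shape_op g subM C sV secX.1.
  have memD := mem_distribution_of_trivial_orth subM (cr_distribution CR) triv.
  by split=> // p; exact: memD sA p.
have -> : X = fun=> 0 by apply/funext; exact: triv.
have -> : shape_op iota g C V (fun=> 0) = fun=> 0.
  by apply/funext => p; rewrite /shape_op (cov_along_zerol si) tan_part0 oppr0.
split=> [p|p u _]; first exact: smooth_vf0.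
rewrite /Defs.induced (linear_fun0 (dmap_linear si p)).
exact: linear_fun0 (ip_linr g _ _).
Qed.

Lemma mixed_totally_geodesic_iff :
  mixed_totally_geodesic iota g C D <->
  forall V, normal_field iota g V ->
    (forall X, secD X -> secD (shape_op iota g C V X)) /\
    (forall X, sections Dperp X -> sections Dperp (shape_op iota g C V X)).
Proof.
split=> [/trivial_orth_of_mixed/shape_of_trivial_orth //|shape].
apply/mixed_of_trivial_orth/trivial_orth_of_shape => V nV X.
exact: (shape V nV).2.
Qed.

End MixedTotallyGeodesic.

Theorem theorem3p14 (R : realType) (n m : nat)
    (Mbar : manifold R n) (g : riem_metric Mbar)
    (nb nbs nblc : connection Mbar)
    (phi : tensor11 Mbar) (xi : Mbar -> 'rV[R]_n) (eta : one_form Mbar)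
    (M : manifold R m) (iota : M -> Mbar) (D : M -> {vspace 'rV[R]_m}) :
  sasakian_statistical g nb nblc phi xi eta ->
  dual_connection g nb nbs ->
  submanifold iota ->
  contact_CR iota g phi xi D ->
  (mixed_totally_geodesic iota g nb D <->
   forall V, normal_field iota g V ->
     (forall X, sections (fun p => [set` D p]) X ->
        sections (fun p => [set` D p]) (shape_op iota g nb V X)) /\
     (forall X, sections (orth_distribution iota g D) X ->
        sections (orth_distribution iota g D) (shape_op iota g nb V X)))
  /\
  (mixed_totally_geodesic iota g nbs D <->
   forall V, normal_field iota g V ->
     (forall X, sections (fun p => [set` D p]) X ->
        sections (fun p => [set` D p]) (shape_op iota g nbs V X)) /\
     (forall X, sections (orth_distribution iota g D) X ->
        sections (orth_distribution iota g D) (shape_op iota g nbs V X))).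
Proof.
move=> sas dual sub CR; have acm := sas_acm sas.
have stat := sas_statistical sas.
have xiC := ip_nabla_xi_phi sas.
have xiCs p v := ip_dual_nabla_xi_phi sas p v dual.
split.
  exact: (mixed_totally_geodesic_iff acm sub CR dual stat.1 xiC xiCs).
exact: (mixed_totally_geodesic_iff acm sub CR (dual_connection_sym dual)
  (dual_torsion_free stat dual) xiCs xiC).
Qed.
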